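(* Let $\Omega\subset\mathbb{R}^2$ be a bounded open set with smooth boundary, let $k>3$ be an integer, let $g$ be a $C^1$ function on $\partial\Omega$, and let $w_0\in H^k$ satisfy $w_0=g$ on $\partial\Omega$. With $E$, $P_0$, $\nabla_{H^3}E$ and $M_{k,0}$ as defined in the context, the gradient flow $$z(0)=w_0,\qquad z'(t)=-M_{k,0}\,P_0\,\nabla_{H^3}E(z(t))$$ has a unique global solution $z\in C^1([0,\infty),H^k)$.
   Context: All functions are real valued. For an integer $m\ge 1$, $H^m=H^{m,2}(\Omega)=W^{m,2}(\Omega)$ is the $L^2$-based Sobolev space with inner product $\langle u,v\rangle_{H^m}=\sum_{0\le|\alpha|\le m}\langle D^\alpha u,D^\alpha v\rangle_{L^2(\Omega)}$, and $H^m_0$ is the closure in $H^m$ of $C_0^\infty(\Omega)$ (infinitely differentiable functions with compact support in $\Omega$). Write $\|\cdot\|$ for the $L^2(\Omega)$ norm and $\nabla^\perp u=(-\partial_2u,\partial_1u)$. For $u\in H^3$ put $F(Du)=\nabla^\perp u\cdot\nabla\Delta u$, which lies in $L^2(\Omega)$. Let $P_0$ be the orthogonal projection (with respect to $\langle\cdot,\cdot\rangle_{H^3}$) of $H^3$ onto $H^3_0$. The energy $E:H^3\to\mathbb{R}$ is $$E(u)=\tfrac12\|F(D(P_0u))\|^2 .$$ $E$ is Fréchet differentiable on $H^3$, and $E'(u)$ denotes its Fréchet derivative at $u$. The Sobolev gradient $\nabla_{H^3}E(u)\in H^3$ is the unique element with $E'(u)h=\langle h,\nabla_{H^3}E(u)\rangle_{H^3}$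 for all $h\in H^3$. For an integer $k>3$ and $x\in H^3_0$, $M_{k,0}x$ is the unique element of $H^k_0$ such that $\langle y,x\rangle_{H^3}=\langle y,M_{k,0}x\rangle_{H^k}$ for all $y\in H^k_0$. *)

(* Defs.v *)
From HB Require Import structures.
From mathcomp Require Import all_boot all_order all_algebra.
From mathcomp Require Import all_classical all_reals all_analysis.
From mathcomp Require Import measurable_realfun ring_quotient ring lra.
Set Implicit Arguments.
Unset Strict Implicit.
Unset Printing Implicit Defensive.
Import Order.TTheory GRing.Theory Num.Theory.
Import numFieldNormedType.Exports.
Local Open Scope classical_set_scope.
Local Open Scope ring_scope.
Local Open Scope quotient_scope.

(* The space of square-integrable functions modulo equality almost everywhere.
   It is built as a quotient of LfunType because LspaceType carries no
   vector-space structure. *)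
Section L2.
Context d (T : measurableType d) (R : realType).
Variable mu : {measure set T -> \bar R}.

Lemma le1_2 : (1 <= 2%:E :> \bar R)%E.
Proof. by rewrite lee_fin ler1n. Qed.

Local Notation L := (LfunType mu le1_2).

Definition ae_null : {pred L} := fun f => `[< {ae mu, forall x, f x = 0} >].

Lemma ae_null_submod : submod_closed ae_null.
Proof.
split; first by apply/asboolP; apply: aeW.
move=> a f g /asboolP f0 /asboolP g0; apply/asboolP.
apply: filterS2 f0 g0 => x fx gx.
by change (a * f x + g x = 0); rewrite fx gx mulr0 addr0.
Qed.

HB.instance Definition _ := GRing.isSubmodClosed.Build _ _ ae_null ae_null_submod.

Definition L2 : Type := {ideal_quot ae_null}.
HB.instance Definition _ := GRing.Zmodule.on L2.
HB.instance Definition _ := EqQuotient.on L2.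

Definition L2_fun (u : L2) : T -> R := repr u.
Coercion L2_fun : L2 >-> Funclass.

Lemma L2_eqP (f g : L) : (\pi_L2 f = \pi_L2 g) <-> {ae mu, forall x, f x = g x}.
Proof.
split.
  move=> /eqP; rewrite -Quotient.idealrBE => /asboolP; apply: filterS => x fg.
  by apply/eqP; rewrite -subr_eq0; apply/eqP.
move=> fg; apply/eqP; rewrite -Quotient.idealrBE; apply/asboolP.
apply: filterS fg => x fg.
by change (f x - g x = 0); rewrite fg subrr.
Qed.

Lemma L2_piE (f : L) : {ae mu, forall x, (\pi_L2 f : L2) x = f x}.
Proof. by apply/L2_eqP; rewrite reprK. Qed.

Lemma L2_ext (u v : L2) : {ae mu, forall x, u x = v x} -> u = v.
Proof. by move=> uv; rewrite -[u]reprK -[v]reprK; apply/L2_eqP. Qed.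

Definition L2_scale (a : R) (u : L2) : L2 := \pi_L2 (a *: repr u).

Lemma L2_scaleE a u : {ae mu, forall x, (L2_scale a u) x = a * u x}.
Proof. exact: L2_piE. Qed.

Lemma L2_addE (u v : L2) : {ae mu, forall x, (u + v : L2) x = u x + v x}.
Proof.
have -> : u + v = \pi_L2 (repr u + repr v) by rewrite Quotient.pi_add !reprK.
exact: L2_piE.
Qed.

Lemma L2_0E : {ae mu, forall x, (0 : L2) x = 0}.
Proof.
have -> : (0 : L2) = \pi_L2 (0 : L) by rewrite piE.
exact: (L2_piE 0).
Qed.

Fact L2_scaleA a b v : L2_scale a (L2_scale b v) = L2_scale (a * b) v.
Proof.
apply: L2_ext.
apply: filterS3 (L2_scaleE a (L2_scale b v)) (L2_scaleE b v)
  (L2_scaleE (a * b) v) => x -> -> ->.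
by rewrite mulrA.
Qed.

Fact L2_scale1 : left_id 1 L2_scale.
Proof.
by move=> v; apply: L2_ext; apply: filterS (L2_scaleE 1 v) => x ->; rewrite mul1r.
Qed.

Fact L2_scaleDr : right_distributive L2_scale +%R.
Proof.
move=> a u v; apply: L2_ext.
near=> x.
rewrite (near (L2_scaleE a (u + v)) x)// (near (L2_addE u v) x)//.
rewrite (near (L2_addE (L2_scale a u) (L2_scale a v)) x)//.
rewrite (near (L2_scaleE a u) x)// (near (L2_scaleE a v) x)//.
by rewrite mulrDr.
Unshelve. all: by end_near. Qed.

Fact L2_scaleDl v : {morph L2_scale^~ v : a b / a + b}.
Proof.
move=> a b; apply: L2_ext.
near=> x.
rewrite (near (L2_addE (L2_scale a v) (L2_scale b v)) x)//.
rewrite (near (L2_scaleE a v) x)// (near (L2_scaleE b v) x)//.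
by rewrite (near (L2_scaleE (a + b) v) x)// mulrDl.
Unshelve. all: by end_near. Qed.

HB.instance Definition _ := GRing.Zmodule_isLmodule.Build R L2
  L2_scaleA L2_scale1 L2_scaleDr L2_scaleDl.

Lemma L2_linE a (u v : L2) : {ae mu, forall x, (a *: u + v : L2) x = a * u x + v x}.
Proof.
near=> x.
rewrite (near (L2_addE (a *: u) v) x)//.
by rewrite (near (L2_scaleE a u) x)//.
Unshelve. all: by end_near. Qed.

Lemma L2_Lfun (u : L2) : (u : T -> R) \in Lfun mu 2%:E.
Proof. exact: LfunP. Qed.

Lemma Lfun2_integrable_mul (f g : T -> R) :
  f \in Lfun mu 2%:E -> g \in Lfun mu 2%:E ->
  mu.-integrable setT (EFin \o (fun x => f x * g x)).
Proof. by move=> lf lg; apply/Lfun1_integrable; exact: Lfun2_mul_Lfun1. Qed.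

Lemma Rintegral_mul_lin (f g h f' : T -> R) a :
  f \in Lfun mu 2%:E -> g \in Lfun mu 2%:E -> h \in Lfun mu 2%:E ->
  measurable_fun setT f' -> {ae mu, forall x, f' x = a * f x + g x} ->
  \int[mu]_x (f' x * h x) = a * (\int[mu]_x (f x * h x)) + \int[mu]_x (g x * h x).
Proof.
move=> lf lg lh mf' f'E.
have mh : measurable_fun setT h by move: lh; rewrite inE => /andP[]; rewrite inE.
have ifh := Lfun2_integrable_mul lf lh.
have igh := Lfun2_integrable_mul lg lh.
have mf : measurable_fun setT f by move: lf; rewrite inE => /andP[]; rewrite inE.
have mg : measurable_fun setT g by move: lg; rewrite inE => /andP[]; rewrite inE.
have -> : \int[mu]_x (f' x * h x) = \int[mu]_x (a * (f x * h x) + g x * h x).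
  congr fine; apply: ae_eq_integral => //.
  - by apply/measurable_EFinP; exact: measurable_funM.
  - apply/measurable_EFinP; apply: measurable_funD; last exact: measurable_funM.
    by apply: measurable_funM => //; exact: measurable_funM.
  - by apply: filterS f'E => x -> _; rewrite mulrDl mulrA.
rewrite RintegralD//; last first.
  by have := integrableZl measurableT a ifh; apply: eq_integrable.
by rewrite RintegralZl.
Qed.

Definition L2_dot (u v : L2) : R := \int[mu]_x (u x * v x).

Lemma L2_dotC u v : L2_dot u v = L2_dot v u.
Proof. by congr fine; apply: eq_integral => x _; rewrite mulrC. Qed.

Lemma L2_dot_lin a u v w : L2_dot (a *: u + v) w = a * L2_dot u w + L2_dot v w.
Proof.
apply: Rintegral_mul_lin; try exact: L2_Lfun; last exact: L2_linE.
by have := L2_Lfun (a *: u + v); rewrite inE => /andP[]; rewrite inE.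
Qed.

Lemma L2_dot_ge0 u : 0 <= L2_dot u u.
Proof. by apply: Rintegral_ge0 => x _; rewrite -expr2 sqr_ge0. Qed.

Lemma L2_dot_eq0 u : L2_dot u u = 0 -> u = 0.
Proof.
move=> u0; apply: L2_ext.
have iu := Lfun2_integrable_mul (L2_Lfun u) (L2_Lfun u).
have : (\int[mu]_x (u x * u x)%:E = 0)%E.
  rewrite -[LHS]fineK ?integrable_fin_num//.
  by rewrite -[fine _]/(L2_dot u u) u0.
move/integrableP: (iu) => [mfu _].
have -> : (\int[mu]_x (u x * u x)%:E = \int[mu]_x `|(u x * u x)%:E|)%E.
  by apply: eq_integral => x _; rewrite gee0_abs// lee_fin -expr2 sqr_ge0.
move=> /(ae_eq_integral_abs _ measurableT mfu) => ue.
apply: filterS2 ue L2_0E => x ux ->.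
by have /eqP := ux I; rewrite /= eqe mulf_eq0 orbb => /eqP.
Qed.

End L2.

(* measurableTypeR R is R itself with its Borel sigma-algebra, on which
   lebesgue_measure is defined; the topology on plane R is that of R * R. *)
Notation plane R := (measurableTypeR R * measurableTypeR R)%type.

Section smooth.
Context {R : realType}.

Lemma open_plane_measurable (A : set (plane R)) : open A -> measurable A.
Proof.
move=> oA.
pose box (i : rat * rat * nat) : set (plane R) :=
  ball (ratr i.1.1 : R) (i.2.+1%:R^-1 : R) `*` ball (ratr i.1.2 : R) (i.2.+1%:R^-1 : R).
have mbox i : measurable (box i).
  by apply: measurableX; exact: measurable_ball.
have -> : A = \bigcup_i (if `[< box i `<=` A >] then box i else set0).
  apply/seteqP; split=> [x Ax|x [i _]]; last by case: asboolP => [iA|//]; exact: iA.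
  have /nbhs_ballP[e /= e0 xeA] : nbhs x A by exact: open_nbhs_nbhs.
  have [n ne] : exists n : nat, n.+1%:R^-1 < e / 2.
    have e2 : 0 < e / 2 by rewrite divr_gt0.
    exact: filter_ex (near_infty_natSinv_lt (PosNum e2)).
  have n0 : 0 < n.+1%:R^-1 :> R by rewrite invr_gt0.
  have rat_near (y : R) : exists q : rat, ball (ratr q : R) n.+1%:R^-1 y.
    have /(rat_in_itvoo) [q] : y - n.+1%:R^-1 < y + n.+1%:R^-1.
      by rewrite ltrBlDr -addrA ltrDl addr_gt0.
    rewrite in_itv /= => /andP[q1 q2]; exists q; rewrite /ball /= ltr_distl q2 /=.
    by rewrite andbT.
  have [q1 xq1] := rat_near x.1.
  have [q2 xq2] := rat_near x.2.
  exists (q1, q2, n) => //.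
  case: asboolP => [_ //|/= ]; case => y [y1 y2]; apply: xeA.
  have tri (q z w : R) : ball q n.+1%:R^-1 z -> ball q n.+1%:R^-1 w -> ball z e w.
    move=> /ball_sym zq qw; have := ball_triangle zq qw; apply: le_ball.
    by move: ne; set c : R := _^-1; lra.
  by split; [exact: tri xq1 y1|exact: tri xq2 y2].
apply: countable_bigcupT_measurable => [|i]; first exact: countableP.
by case: ifP.
Qed.

Lemma continuous_plane_measurable (f : plane R -> R) :
  continuous f -> measurable_fun setT f.
Proof.
move=> cf; apply: (measurability _ (RGenOpens.measurableE R)) => _ [_ [a [b ->]] <-].
rewrite setTI; apply: open_plane_measurable.
by move/continuousP: cf; apply; exact: interval_open.
Qed.


(* Functions of class C^n on a finite-dimensional space: f is C^n.+1 when it is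
   differentiable everywhere and all its directional derivatives are C^n. *)
Fixpoint Ck (V W : normedModType R) (n : nat) (f : V -> W) : Prop :=
  if n is p.+1 then
    (forall x, differentiable f x) /\ (forall v, Ck p (fun x => 'D_v f x))
  else continuous f.

Definition smooth (V W : normedModType R) (f : V -> W) := forall n, Ck n f.

(* pderiv (i, j) f is the classical derivative d1^i d2^j f. *)
Definition pderiv (a : nat * nat) (f : plane R -> R) : plane R -> R :=
  iter a.1 (fun h x => 'D_((1, 0) : plane R) h x)
    (iter a.2 (fun h x => 'D_((0, 1) : plane R) h x) f).

(* C_0^oo(Omega), the functions being extended by zero outside Omega. *)
Definition test_fun (Omega : set (plane R)) (phi : plane R -> R) :=
  smooth phi /\
  exists2 K, compact K & K `<=` Omega /\ forall x, ~ K x -> phi x = 0.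

Lemma smooth_pderiv a f : smooth f -> smooth (pderiv a f).
Proof.
have it v n (h : plane R -> R) :
    smooth h -> smooth (iter n (fun h x => 'D_v h x) h).
  by elim: n => [//|n IH] /IH{}IH p; have [_] := IH p.+1; apply.
by move=> sf; apply/it/it.
Qed.

Lemma pderiv_support (K : set (plane R)) a f : closed K ->
  (forall x, ~ K x -> f x = 0) -> forall x, ~ K x -> pderiv a f x = 0.
Proof.
move=> cK.
have it v n (h : plane R -> R) : (forall x, ~ K x -> h x = 0) ->
    forall x, ~ K x -> iter n (fun h x => 'D_v h x) h x = 0.
  elim: n => [//|n IH] /IH{}IH x Kx /=.
  rewrite (@near_eq_derive _ _ _ _ (cst 0)) ?derive_cst//.
  have : nbhs x (~` K) by apply: open_nbhs_nbhs; split => //; exact: closed_openC.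
  by apply: filterS => y; exact: IH.
by move=> f0; apply/it/it.
Qed.


Lemma compact_area (K : set (plane R)) : compact K ->
  ((lebesgue_measure \x lebesgue_measure) K < +oo)%E.
Proof.
move=> cK.
have mK : measurable K.
  rewrite -[K]setCK; apply: measurableC; apply: open_plane_measurable.
  by apply: closed_openC; apply: compact_closed => //; exact: norm_hausdorff.
have [N [_ KN]] := compact_bounded cK.
pose M := `|N| + 1.
have KM : K `<=` `[- M, M] `*` `[- M, M].
  move=> x Kx; have : `|x| <= M by apply: KN => //; rewrite ltr_pwDr// ler_norm.
  rewrite /Num.norm/= ge_max => /andP[x1 x2].
  by split; rewrite /= in_itv /= -ler_norml.
have mI : measurable (`[- M, M] : set (measurableTypeR R)) by exact: measurable_itv.
apply: (@le_lt_trans _ _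
  ((lebesgue_measure \x lebesgue_measure)%E (`[- M, M] `*` `[- M, M]))).
  by apply: le_measure => //; rewrite inE//; exact: measurableX.
rewrite product_measure1E//= lebesgue_measure_itv /=.
by case: ifP => _; rewrite -?EFinD -?EFinM ?mule0 ltry.
Qed.

Definition boundary (A : set (plane R)) := closure A `\` A°.

(* Near each boundary point, A is one of the two sides of the graph of a
   C^oo function over one of the coordinate axes. *)
Definition smooth_boundary (A : set (plane R)) :=
  forall p, boundary A p -> exists2 gamma : R -> R, smooth gamma &
    [\/ \forall x \near p, A x <-> gamma x.1 < x.2,
        \forall x \near p, A x <-> x.2 < gamma x.1,
        \forall x \near p, A x <-> gamma x.2 < x.1 |
        \forall x \near p, A x <-> x.1 < gamma x.2].

(* C^1 functions on a subset of the plane, in the usual sense for a submanifold: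
   locally, g is the restriction of a C^1 function. Only the values of g on A
   matter. *)
Definition C1_on (A : set (plane R)) (g : plane R -> R) :=
  forall p, A p -> exists2 G : plane R -> R, Ck 1 G &
    \forall x \near p, A x -> g x = G x.

(* Derivative at t >= 0 of a function on [0, +oo[: it is one-sided at t = 0, and
   the values of z at negative times play no role. *)
Definition has_deriv_from0 (V : normedModType R) (z : R -> V) (t : R) (v : V) :=
  h^-1 *: (z (t + h) - z t) @[h --> within [set h | 0 <= t + h] 0^'] --> v.

Definition C1_from0 (V : normedModType R) (z dz : R -> V) :=
  (forall t, 0 <= t -> has_deriv_from0 z t (dz t)) /\
  {within `[0, +oo[, continuous dz}.

Section restricted.
Variables (Omega : set (plane R)) (oO : open Omega).

Definition area_on : {measure set (plane R) -> \bar R} :=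
  mrestr (lebesgue_measure \x lebesgue_measure)%E (open_plane_measurable oO).

Lemma continuous_compact_Lfun (K : set (plane R)) (f : plane R -> R) :
  compact K -> continuous f -> (forall x, ~ K x -> f x = 0) ->
  f \in Lfun area_on 2%:E.
Proof.
move=> cK cf f0.
have mf := continuous_plane_measurable cf.
have mK : measurable K.
  rewrite -[K]setCK; apply: measurableC; apply: open_plane_measurable.
  by apply: closed_openC; apply: compact_closed => //; exact: norm_hausdorff.
rewrite inE; apply/andP; split; first by rewrite inE.
rewrite inE /= /finite_norm unlock /Lnorm; apply: poweR_lty.
have mf2 : measurable_fun setT (fun x => `|f x| ^+ 2).
  by apply: measurable_funX; exact: measurableT_comp.
have : (area_on).-integrable K (EFin \o (fun x => `|f x| ^+ 2)).
  apply: measurable_bounded_integrable => //.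
  - rewrite /area_on /= /mrestr; apply: le_lt_trans (compact_area cK).
    apply: le_measure; rewrite ?inE//.
    by apply: measurableI => //; exact: open_plane_measurable.
  - exact: measurable_funTS.
  - have /compact_bounded : compact ((fun x => `|f x| ^+ 2) @` K).
      apply: continuous_compact => //; apply: continuous_subspaceT => x.
      by apply: cvgM; apply: cvg_norm; exact: cf.
    case=> M [rM MK]; exists M; split=> // y My x Kx /=.
    by apply: (MK _ My); exists x.
move=> /integrableP[_]; rewrite (integral_mkcond K)/=.
apply: le_lt_trans; rewrite le_eqVlt; apply/orP; left; apply/eqP.
apply: eq_integral => x _ /=; rewrite patchE; case: ifPn => [xK|].
  by rewrite powR_mulrn// normrX normr_id.
by rewrite notin_setE => /f0 ->; rewrite normr0 powR0.
Qed.

Lemma test_fun_Lfun a phi : test_fun Omega phi ->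
  pderiv a phi \in Lfun area_on 2%:E.
Proof.
move=> [sphi [K cK [_ phi0]]]; apply: (continuous_compact_Lfun cK).
  exact: (smooth_pderiv a sphi 0%N).
apply: pderiv_support => //; apply: compact_closed => //; exact: norm_hausdorff.
Qed.

End restricted.
End smooth.

Section sobolev.
Context {R : realType} (Omega : set (plane R)) (oO : open Omega).
Local Notation mu := (area_on oO).

Definition multi_index (m : nat) := {a : 'I_m.+1 * 'I_m.+1 | (a.1 + a.2 <= m)%N}.
HB.instance Definition _ m := Finite.on (multi_index m).

Fact multi_subproof1 m i j : (i + j <= m)%N -> (i < m.+1)%N.
Proof. by rewrite ltnS; apply: leq_trans; exact: leq_addr. Qed.

Fact multi_subproof2 m i j : (i + j <= m)%N -> (j < m.+1)%N.
Proof. by rewrite ltnS; apply: leq_trans; exact: leq_addl. Qed.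

Definition multi m i j (h : (i + j <= m)%N) : multi_index m :=
  exist _ (Ordinal (multi_subproof1 h), Ordinal (multi_subproof2 h)) h.

Definition midx m (a : multi_index m) : nat * nat :=
  (val (val a).1, val (val a).2).

Definition morder m (a : multi_index m) : nat := ((midx a).1 + (midx a).2)%N.

Definition multi0 m : multi_index m := @multi m 0 0 isT.

Definition multi_widen m n (mn : (m <= n)%N) (a : multi_index m) : multi_index n :=
  @multi n (midx a).1 (midx a).2 (leq_trans (valP a) mn).

(* An element of H^m = W^(m,2)(Omega) is a function u_0 of L^2(Omega) bundled
   with its weak derivatives: the family (u_a)_(|a| <= m) of elements of
   L^2(Omega) such that u_a = D^a u_0 in the sense of distributions. The u_a are
   determined by u_0 (du Bois-Reymond), so that this is the usual realisation of
   W^(m,2)(Omega) as a subspace of a power of L^2(Omega). *)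
Definition weak_derivs (m : nat) : {pred {ffun multi_index m -> L2 mu}} :=
  fun u => `[< forall (a : multi_index m) phi, test_fun Omega phi ->
    \int[mu]_x (u (multi0 m) x * pderiv (midx a) phi x) =
    (-1) ^+ morder a * \int[mu]_x (u a x * phi x) >].
Arguments weak_derivs m : clear implicits.

Lemma weak_derivs_submod m : submod_closed (weak_derivs m).
Proof.
have mL (w : L2 mu) : measurable_fun setT (w : plane R -> R).
  by have := L2_Lfun w; rewrite inE => /andP[]; rewrite inE.
have lin c (u v : {ffun multi_index m -> L2 mu}) b h : h \in Lfun mu 2%:E ->
    \int[mu]_x (((c *: u + v) b : L2 mu) x * h x) =
    c * \int[mu]_x (u b x * h x) + \int[mu]_x (v b x * h x).
  move=> lh; rewrite !ffunE.
  by apply: Rintegral_mul_lin => //; [exact: L2_Lfun|exact: L2_Lfun|exact: L2_linE].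
have lin0 (b : multi_index m) h : h \in Lfun mu 2%:E ->
    \int[mu]_x (((0 : {ffun multi_index m -> L2 mu}) b : L2 mu) x * h x) = 0.
  move=> lh; have := @lin (-1) 0 0 b h lh.
  by rewrite scaler0 addr0 mulN1r addNr.
split.
  apply/asboolP => a phi tphi.
  rewrite !lin0 ?mulr0//; first exact: (test_fun_Lfun _ (0, 0)%N).
  exact: test_fun_Lfun.
move=> c u v /asboolP uP /asboolP vP; apply/asboolP => a phi tphi.
rewrite !lin ?uP ?vP//; first by rewrite mulrDr mulrCA.
  exact: (test_fun_Lfun _ (0, 0)%N).
exact: test_fun_Lfun.
Qed.

HB.instance Definition _ m := GRing.isSubmodClosed.Build _ _ (weak_derivs m)
  (weak_derivs_submod m).

Record sobolev m := Sobolev {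
  sobolev_val :> {ffun multi_index m -> L2 mu};
  _ : sobolev_val \in weak_derivs m }.

HB.instance Definition _ m := [isSub for @sobolev_val m].
HB.instance Definition _ m := [Choice of sobolev m by <:].
HB.instance Definition _ m := [SubChoice_isSubLmodule of sobolev m by <:].

Definition sob_dot m (u v : sobolev m) : R := \sum_a L2_dot (u a) (v a).

Lemma sob_dotC m (u v : sobolev m) : sob_dot u v = sob_dot v u.
Proof. by apply: eq_bigr => a _; exact: L2_dotC. Qed.

Lemma sob_dot_lin m c (u v w : sobolev m) :
  sob_dot (c *: u + v) w = c * sob_dot u w + sob_dot v w.
Proof.
rewrite /sob_dot mulr_sumr -big_split /=; apply: eq_bigr => a _.
by rewrite -L2_dot_lin !ffunE.
Qed.

Lemma sob_dot_ge0 m (u : sobolev m) : 0 <= sob_dot u u.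
Proof. by apply: sumr_ge0 => a _; exact: L2_dot_ge0. Qed.

Lemma sob_dot_eq0 m (u : sobolev m) : sob_dot u u = 0 -> u = 0.
Proof.
move=> /eqP; rewrite psumr_eq0; last by move=> a _; exact: L2_dot_ge0.
move=> /allP u0; apply: val_inj; apply/ffunP => a; rewrite ffunE.
by apply: L2_dot_eq0; apply/eqP; apply: (u0 a); rewrite mem_index_enum.
Qed.

Definition sob_norm m (u : sobolev m) : R := Num.sqrt (sob_dot u u).

Lemma sob_dotDl m (u v w : sobolev m) :
  sob_dot (u + v) w = sob_dot u w + sob_dot v w.
Proof. by rewrite -[u]scale1r sob_dot_lin mul1r scale1r. Qed.

Lemma sob_dotZl m c (u w : sobolev m) : sob_dot (c *: u) w = c * sob_dot u w.
Proof.
have := sob_dot_lin c u 0 w; rewrite addr0 => ->.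
by have := sob_dot_lin (-1) 0 0 w; rewrite scaler0 addr0 mulN1r addNr => ->; rewrite addr0.
Qed.

Lemma sob_CS m (u v : sobolev m) : sob_dot u v <= sob_norm u * sob_norm v.
Proof.
rewrite /sob_norm -sqrtrM ?sob_dot_ge0//.
have [v0|v0] := eqVneq (sob_dot v v) 0.
  rewrite (sob_dot_eq0 v0) sob_dotC -[0](scale0r u) sob_dotZl mul0r.
  exact: sqrtr_ge0.
have vp : 0 < sob_dot v v by rewrite lt_def v0 sob_dot_ge0.
apply: le_trans (ler_norm _) _; rewrite -sqrtr_sqr ler_wsqrtr//.
have := sob_dot_ge0 (sob_dot v v *: u + (- sob_dot u v) *: v).
rewrite sob_dotDl !sob_dotZl ![sob_dot _ (_ + _)]sob_dotC !sob_dotDl !sob_dotZl.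
rewrite (sob_dotC v u) mulNr -mulNr => h.
have : 0 <= sob_dot v v * (sob_dot u u * sob_dot v v - sob_dot u v ^+ 2).
  by apply: le_trans h _; rewrite le_eqVlt; apply/orP; left; apply/eqP; ring.
by rewrite pmulr_rge0// subr_ge0.
Qed.

Lemma sob_normD m (u v : sobolev m) : sob_norm (u + v) <= sob_norm u + sob_norm v.
Proof.
have n0 (w : sobolev m) : 0 <= sob_norm w by exact: sqrtr_ge0.
rewrite -(@ler_pXn2r _ 2%N) ?nnegrE ?addr_ge0// [sob_norm (u + v)]/sob_norm.
rewrite sqr_sqrtr ?sob_dot_ge0// sqrrD !sqr_sqrtr ?sob_dot_ge0//.
rewrite sob_dotDl ![sob_dot _ (u + v)]sob_dotC !sob_dotDl (sob_dotC v u).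
have := sob_CS u v; lra.
Qed.

Lemma sob_normZ m (c : R) (u : sobolev m) : sob_norm (c *: u) = `|c| * sob_norm u.
Proof.
rewrite /sob_norm sob_dotZl sob_dotC sob_dotZl mulrA -expr2.
by rewrite sqrtrM ?sqr_ge0// sqrtr_sqr.
Qed.

Lemma sob_norm_eq0 m (u : sobolev m) : sob_norm u = 0 -> u = 0.
Proof.
move=> /eqP; rewrite sqrtr_eq0 => u0; apply: sob_dot_eq0.
by apply/eqP; rewrite eq_le u0 sob_dot_ge0.
Qed.

HB.instance Definition _ m := Lmodule_isNormed.Build R (sobolev m)
  (@sob_normD m) (@sob_normZ m) (@sob_norm_eq0 m).

Lemma sob_incl_subproof m n (mn : (m <= n)%N) (u : sobolev n) :
  [ffun a => u (multi_widen mn a)] \in weak_derivs m.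
Proof.
apply/asboolP => a phi tphi; rewrite !ffunE.
have /asboolP/(_ (multi_widen mn a) phi tphi) := valP u.
by have -> : multi_widen mn (multi0 m) = multi0 n by apply: val_inj; congr pair; exact: val_inj.
Qed.

(* The inclusion of H^n in H^m for m <= n. *)
Definition sob_incl m n (mn : (m <= n)%N) (u : sobolev n) : sobolev m :=
  Sobolev (sob_incl_subproof mn u).

(* H^m_0, the closure being for the norm of H^m. *)
Definition sobolev0 m : set (sobolev m) :=
  closure [set u : sobolev m | exists2 phi, test_fun Omega phi &
    forall a, {ae mu, forall x, u a x = pderiv (midx a) phi x}].

(* w = g on the boundary: w has a representative that is continuous up to the
   boundary and whose boundary values are those of g. For a smooth bounded
   domain and m >= 2, every w in H^m has such a representative. *)
Definition has_boundary_value m (w : sobolev m) (g : plane R -> R) :=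
  exists2 wc : plane R -> R,
    {within closure Omega, continuous wc} /\
    {ae mu, forall x, w (multi0 m) x = wc x} &
    forall x, boundary Omega x -> wc x = g x.

Definition grad_perp (u : sobolev 3) (x : plane R) : R * R :=
  (- u (@multi 3 0 1 isT) x, u (@multi 3 1 0 isT) x).

Definition grad_lap (u : sobolev 3) (x : plane R) : R * R :=
  (u (@multi 3 3 0 isT) x + u (@multi 3 1 2 isT) x,
   u (@multi 3 2 1 isT) x + u (@multi 3 0 3 isT) x).

Definition F_D (u : sobolev 3) (x : plane R) : R :=
  (grad_perp u x).1 * (grad_lap u x).1 + (grad_perp u x).2 * (grad_lap u x).2.

(* In the next definitions xget 0 S is an element of S, namely the element
   characterized by the property defining S, the default value 0 being only used
   if S is empty. *)
Definition P0 (u : sobolev 3) : sobolev 3 :=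
  xget 0 [set v | sobolev0 v /\ forall w, sobolev0 w -> sob_dot w (u - v) = 0].

Definition energy (u : sobolev 3) : R :=
  2^-1 * fine ('N[mu]_2%:E[EFin \o F_D (P0 u)])%E ^+ 2.

Definition sob_grad (E : sobolev 3 -> R) (u : sobolev 3) : sobolev 3 :=
  xget 0 [set v | forall h, 'd E u h = sob_dot h v].

Definition M0 k (hk : (3 <= k)%N) (x : sobolev 3) : sobolev k :=
  xget 0 [set v | sobolev0 v /\
    forall y, sobolev0 y -> sob_dot (sob_incl hk y) x = sob_dot y v].

Definition gradient_flow k (hk : (3 <= k)%N) (w0 : sobolev k)
    (z : R -> sobolev k) :=
  z 0 = w0 /\ exists2 dz, C1_from0 z dz &
    forall t, 0 <= t -> dz t = - M0 hk (P0 (sob_grad energy (sob_incl hk (z t)))).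

End sobolev.

(* Main.v *)
(* On H^3_0 the first derivatives are bounded by the H^3 norm (for test
   functions because |psi| <= int |d1 d2 psi|), so that (v, w) |->
   grad_perp v . grad (lap w) is a bounded bilinear map into L^2 and the energy
   is a bounded quartic form.  Its gradient is therefore locally Lipschitz, and
   so is the vector field G = - M P_0 grad E on H^k, which satisfies
   E'(z) (G z) = - |G z|^2.  Along the flow, also after multiplication of G by a
   cut-off with values in [0, 1], this yields
   |z(t) - z(0)|^2 <= t E(z(0)).  Cutting G off outside a ball whose radius
   grows linearly in t gives a field that is Lipschitz on every bounded time
   interval; its Picard solution is global and by the estimate never reaches
   the region where the field was modified.  Uniqueness is Gronwall's lemma.
   As no vector-valued integral is available, primitives of curves are obtained
   from the Riesz representation theorem. *)
Require Import Defs.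
From HB Require Import structures.
From mathcomp Require Import all_boot all_order all_algebra.
From mathcomp Require Import all_classical all_reals all_analysis.
From mathcomp Require Import measurable_realfun ring lra.
Set Implicit Arguments.
Unset Strict Implicit.
Unset Printing Implicit Defensive.
Import Order.TTheory GRing.Theory Num.Theory.
Import numFieldNormedType.Exports.
Local Open Scope classical_set_scope.
Local Open Scope ring_scope.
Local Open Scope quotient_scope.

(** * Curves in a Hilbert space *)

Section real_analysis.
Context {R : realType}.

(** The identity E'(z) (G z) = - |G z|^2 comes from duality. If y is in H^k_0, then its inclusion in
    H^3 lies in H^3_0, where pairing with P_0 x is the same as pairing with x; hence <y, G z> in H^k
    equals - E'(z) y. So G is minus the gradient of E in the geometry of H^k_0, and G z itself is an
    admissible y. Order three is exactly what the embedding consumes: the function bounded is a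
    first derivative, and d1 d2 of it has order three. Global existence is not automatic, because
    the Lipschitz constant of the gradient of a quartic form grows like the square of the radius.
    The displacement estimate has to hold for the truncated equation, since that is the equation
    which gets solved. Estimates on curves are reduced to scalar ones by pairing the curve with a
    fixed vector and applying the mean value theorem. Choosing as this vector the very quantity to
    be bounded (an end displacement, a remainder) gives back the norm. Existence in the Riesz
    theorem also shows that the sets under [xget] are inhabited, so that no default value
    intervenes. *)

Lemma is_derive_cvgP (W : normedModType R) (z : R -> W) (t : R) v :
  is_derive t 1 z v <-> h^-1 *: (z (h + t) - z t) @[h --> 0^'] --> v.
Proof.
split=> [[zt <-]|zv].
  rewrite -derive1E; have := zt; rewrite /derivable /derive1 /=.
  by under [X in X @ _]eq_fun do rewrite [_%:A]mulr1.
have zt : h^-1 *: ((z \o shift t) (h *: 1) - z t) @[h --> 0^'] --> v.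
  by under [X in X @ _]eq_fun do rewrite /= [_%:A]mulr1.
by apply: DeriveDef; [apply/cvg_ex; exists v|exact: cvg_lim zt].
Qed.

Lemma is_derive_continuous (W : normedModType R) (z : R -> W) (t : R) v :
  is_derive t 1 z v -> {for t, continuous z}.
Proof. by case=> /derivable1_diffP /differentiable_continuous. Qed.

Lemma is_derive_expRM (c t : R) :
  is_derive t 1 (fun s => expR (c * s)) (expR (c * t) * c).
Proof.
have h : is_derive t 1 (fun s => c * s) c.
  by have := is_deriveZ c (is_derive_id t (1 : R)) => h; apply: is_derive_eq h _;
    rewrite [_ *: _]mulr1.
exact: (is_derive1_comp (is_derive_expR (c * t)) h).
Qed.

(** The order of [s] and [t] is left open, and [x] is located only through its distance to [t]. This
    distance is controlled uniformly over a family of functions [p], although [x] varies with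
    [p]. *)
Lemma mvt_between (p f : R -> R) (a s t : R) : a < s -> a < t ->
  (forall x : R, a < x -> is_derive x 1 p (f x)) ->
  exists x, [/\ a < x, `|x - t| <= `|s - t| & p s - p t = f x * (s - t)].
Proof.
move=> + + pf.
have mvt u v : a < u -> u < v -> exists2 c, c \in `]u, v[%R & p v - p u = f c * (v - u).
  move=> au uv; apply: MVT => // [x|]; first by rewrite in_itv => /andP[ux _];
    apply: pf; exact: lt_trans ux.
  apply: derivable_within_continuous => x; rewrite in_itv => /andP[ux _].
  by case: (pf x (lt_le_trans au ux)).
move=> as_ at_; have [st|ts|->] := ltgtP s t.
- have [c + E] := mvt s t as_ st; rewrite in_itv/= => /andP[sc ct]; exists c; split.
  + exact: lt_trans sc.
  + by rewrite !ltr0_norm ?subr_lt0// lerN2 lerD2r ltW.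
  + by rewrite -opprB E -mulrN opprB.
- have [c + E] := mvt t s at_ ts; rewrite in_itv/= => /andP[tc cs]; exists c;
  split => //.
  + exact: lt_trans tc.
  + by rewrite !gtr0_norm ?subr_gt0// lerD2r ltW.
- by exists t; rewrite !subrr mulr0.
Qed.

(** The integral starts at a point [a < 0], so that 0 is an interior point and the derivative there
    is two-sided. *)
Lemma real_primitive (f : R -> R) (a : R) : continuous f -> a < 0 ->
  exists p : R -> R, p 0 = 0 /\ forall t : R, a < t -> is_derive t 1 p (f t).
Proof.
move=> cf a0.
pose F x := (\int[lebesgue_measure]_(t in [set` `[a, x]]) f t)%R.
have FP (t : R) : a < t -> is_derive t 1 F (f t).
  move=> at_; have [||dF Ft] := @continuous_FTC1_closed R f a t (t + 1) _ _ at_ (cf t).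
  - by rewrite ltrDl.
  - apply: continuous_compact_integrable; first exact: segment_compact.
    exact: continuous_subspaceT.
  - by apply: DeriveDef => //; rewrite -derive1E.
exists (fun x => F x - F 0); split=> [|t at_]; first by rewrite subrr.
have h := FP t at_; have h2 := is_derive_cst (F 0) t (1 : R).
by have := is_deriveB h h2; rewrite subr0.
Qed.

Lemma geometric_small (M e : R) : 0 < e -> 0 <= M ->
  exists N, forall n, (N <= n)%N -> M / 2 ^+ n <= e.
Proof.
move=> e0 M0; have d0 : 0 < e / (M + 1) by rewrite divr_gt0// ltr_wpDl.
have [N _ NP] := near_infty_natSinv_expn_lt (PosNum d0).
exists N => n /NP /=; rewrite div1r ltr_pdivlMr ?ltr_wpDl// => h.
by apply: le_trans (ltW h); rewrite mulrC ler_wpM2l ?invr_ge0 ?exprn_ge0// lerDl.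
Qed.

Lemma is_derive_diff_comp (V W : normedModType R) (e : V -> W) (z : R -> V) (t : R) v :
  differentiable e (z t) -> is_derive t 1 z v ->
  is_derive t 1 (fun s => e (z s)) ('d e (z t) v).
Proof.
move=> de [dz <-]; have dz' : differentiable z t by apply/derivable1_diffP.
have dez : differentiable (e \o z) t by exact: differentiable_comp.
apply: DeriveDef; first exact/derivable1_diffP.
by rewrite (deriveE _ dez) (diff_comp dz' de) /= (deriveE _ dz').
Qed.

Lemma lipschitz_at_continuous (V W : normedModType R) (f : V -> W) (a : V) (r L : R) :
  0 < r -> (forall b, `|a - b| <= r -> `|f a - f b| <= L * `|a - b|) ->
  {for a, continuous f}.
Proof.
(* [L] may be zero or negative; [K] is a positive majorant by which [e] can be divided. *)
move=> r0 fL; apply/cvgrPdist_le => e e0; pose K := Num.max L 1.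
have K0 : 0 < K by rewrite /K lt_max ltr01 orbT.
have eK : 0 < e / K by rewrite divr_gt0.
have h1 : \forall b \near a, `|a - b| <= e / K.
  exact: (cvgrPdist_le _ _).1 cvg_id _ eK.
have h2 : \forall b \near a, `|a - b| <= r.
  exact: (cvgrPdist_le _ _).1 cvg_id _ r0.
apply: filterS2 h1 h2 => b ab /fL fab; apply: le_trans fab _.
apply: (@le_trans _ _ (K * `|a - b|)); first by rewrite ler_wpM2r// /K le_max lexx.
by rewrite mulrC -ler_pdivlMr.
Qed.

(** The profile of the cut-off: 1-Lipschitz, equal to 0 on the negative axis and to 1 beyond 1. *)
Definition clamp01 (x : R) : R := Num.max 0 (Num.min 1 x).

Lemma clamp01_ge0 x : 0 <= clamp01 x.
Proof. by rewrite /clamp01 le_max lexx. Qed.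

Lemma clamp01_le1 x : clamp01 x <= 1.
Proof. by rewrite /clamp01 ge_max ler01 ge_min lexx. Qed.

Lemma clamp01_eq1 x : 1 <= x -> clamp01 x = 1.
Proof. by move=> x1; rewrite /clamp01 (min_idPl x1); apply/max_idPr/ler01. Qed.

Lemma clamp01_eq0 x : x <= 0 -> clamp01 x = 0.
Proof. by move=> x0; apply/max_idPl; rewrite ge_min x0 orbT. Qed.

Lemma clamp01_lip x y : `|clamp01 x - clamp01 y| <= `|x - y|.
Proof.
wlog xy : x y / y <= x.
  move=> H; have [/H//|/ltW/H] := leP y x.
  by rewrite distrC [X in _ <= X]distrC.
have mono : clamp01 y <= clamp01 x.
  by rewrite /clamp01 ge_max !le_max lexx/= le_min !ge_min lexx xy !orbT.
rewrite !ger0_norm ?subr_ge0// /clamp01 /Num.max /Num.min.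
by repeat case: ifPn; rewrite -?leNgt; lra.
Qed.

Lemma clamp01_continuous : continuous clamp01.
Proof.
move=> x; apply: (@lipschitz_at_continuous _ _ _ _ 1 1) => // y _.
by rewrite mul1r; exact: clamp01_lip.
Qed.

End real_analysis.

(** * Riesz representation, primitives of curves and Picard iteration *)

Section hilbert.
Context {R : realType} {V : normedModType R}.

Record inner_product (dot : V -> V -> R) : Prop := InnerProduct {
  ip_sym : forall u v, dot u v = dot v u;
  ip_lin : forall a u v w, dot (a *: u + v) w = a * dot u w + dot v w;
  ip_norm : forall u, dot u u = `|u| ^+ 2 }.

(** Stated on sequences and used as a hypothesis, so that the results apply to any normed space
    whose norm comes from some [dot]. *)
Definition cauchy_complete := forall u : nat -> V,
  (forall e : R, 0 < e -> exists N, forall m n, (N <= m)%N -> (N <= n)%N ->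
     `|u m - u n| <= e) -> exists l : V, u n @[n --> \oo] --> l.

Variable dot : V -> V -> R.
Hypothesis ip : inner_product dot.

Lemma ip0l w : dot 0 w = 0.
Proof. by have := ip_lin ip (-1) 0 0 w; rewrite scaler0 addr0 mulN1r addNr. Qed.

Lemma ipDl u v w : dot (u + v) w = dot u w + dot v w.
Proof. by rewrite -[u]scale1r (ip_lin ip) mul1r scale1r. Qed.

Lemma ipZl a u w : dot (a *: u) w = a * dot u w.
Proof. by rewrite -[a *: u]addr0 (ip_lin ip) ip0l addr0. Qed.

Lemma ipNl u w : dot (- u) w = - dot u w.
Proof. by rewrite -scaleN1r ipZl mulN1r. Qed.

Lemma ipBl u v w : dot (u - v) w = dot u w - dot v w.
Proof. by rewrite ipDl ipNl. Qed.

Lemma ipDr u v w : dot w (u + v) = dot w u + dot w v.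
Proof. by rewrite !(ip_sym ip w) ipDl. Qed.

Lemma ipZr a u w : dot w (a *: u) = a * dot w u.
Proof. by rewrite !(ip_sym ip w) ipZl. Qed.

Lemma ipNr u w : dot w (- u) = - dot w u.
Proof. by rewrite !(ip_sym ip w) ipNl. Qed.

Lemma ipBr u v w : dot w (u - v) = dot w u - dot w v.
Proof. by rewrite !(ip_sym ip w) ipBl. Qed.

Lemma ip_norm_sqrB u v : `|u - v| ^+ 2 = `|u| ^+ 2 - 2 * dot u v + `|v| ^+ 2.
Proof. by rewrite -!(ip_norm ip) !(ipBl, ipBr) (ip_sym ip v u); ring. Qed.

Lemma ip_norm_sqrD u v : `|u + v| ^+ 2 = `|u| ^+ 2 + 2 * dot u v + `|v| ^+ 2.
Proof. by rewrite -!(ip_norm ip) !(ipDl, ipDr) (ip_sym ip v u); ring. Qed.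

Lemma ip_cauchy_schwarz u v : `|dot u v| <= `|u| * `|v|.
Proof.
have [->|v0] := eqVneq v 0; first by rewrite (ip_sym ip) ip0l !normr0 mulr0.
have vp : 0 < `|v| by rewrite normr_gt0.
rewrite -(@ler_pXn2r _ 2%N) ?nnegrE ?mulr_ge0// real_normK ?num_real// exprMn.
have := sqr_ge0 `|(`|v| ^+ 2) *: u - dot u v *: v|.
rewrite ip_norm_sqrB !normrZ ipZl ipZr normr_id !exprMn real_normK ?num_real//.
have v2 : 0 < `|v| ^+ 2 by rewrite exprn_gt0.
move: v2; set a := `|v| ^+ 2; set b := `|u| ^+ 2; set c := dot u v => a0 h.
have : 0 <= a * (b * a - c ^+ 2).
  by move: h; rewrite -!expr2 -/a -/c; nra.
by rewrite pmulr_rge0// subr_ge0.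
Qed.

Lemma ip_le u v : dot u v <= `|u| * `|v|.
Proof. exact: le_trans (ler_norm _) (ip_cauchy_schwarz _ _). Qed.

Lemma ip_inj u v : (forall w, dot u w = dot v w) -> u = v.
Proof.
move=> uv; apply/eqP; rewrite -subr_eq0 -normr_eq0 -sqrf_eq0 -(ip_norm ip).
by rewrite ipBl uv subrr.
Qed.

Lemma ip_cvg T (F : set_system T) {FF : Filter F} (u v : T -> V) a b :
  u x @[x --> F] --> a -> v x @[x --> F] --> b ->
  dot (u x) (v x) @[x --> F] --> dot a b.
Proof.
have polar c d : dot c d = 2^-1 * (`|c + d| ^+ 2 - `|c| ^+ 2 - `|d| ^+ 2).
  by rewrite ip_norm_sqrD; move: (`|c| ^+ 2) (`|d| ^+ 2) => x y; field.
have sq (w : T -> V) l : w x @[x --> F] --> l -> `|w x| ^+ 2 @[x --> F] --> `|l| ^+ 2.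
  by move=> wl; apply: cvgM; exact: cvg_norm.
move=> ua vb; rewrite polar; under eq_fun do rewrite polar.
apply: cvgMr; apply: cvgB; last exact: sq.
by apply: cvgB; apply: sq => //; exact: cvgD.
Qed.

Lemma ip_cvgl T (F : set_system T) {FF : Filter F} (u : T -> V) l w :
  u x @[x --> F] --> l -> dot (u x) w @[x --> F] --> dot l w.
Proof. by move=> ul; apply: ip_cvg ul (cvg_cst _). Qed.

Lemma ip_cvgr T (F : set_system T) {FF : Filter F} (u : T -> V) l w :
  u x @[x --> F] --> l -> dot w (u x) @[x --> F] --> dot w l.
Proof. by move=> /ip_cvgl-/(_ w); under eq_fun do rewrite (ip_sym ip);
  rewrite (ip_sym ip). Qed.

(* The representer minimises |v|^2 / 2 - ell v over S; minimising sequences are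
   Cauchy by the parallelogram law. *)
Lemma riesz (S : set V) (ell : V -> R) (C : R) :
  cauchy_complete -> closed S -> S 0 ->
  (forall a u v, S u -> S v -> S (a *: u + v)) ->
  (forall a u v, S u -> S v -> ell (a *: u + v) = a * ell u + ell v) ->
  (forall u, S u -> `|ell u| <= C * `|u|) ->
  exists2 v, S v & forall y, S y -> dot y v = ell y.
Proof.
move=> cV cS S0 Slin ell_lin ellC.
pose J v : R := `|v| ^+ 2 / 2 - ell v.
(* Along a line [J] is a quadratic polynomial. Its values at a = 1/2 and a = 1 give the
   parallelogram estimate [vB]; another value of a gives the optimality condition [dn]. *)
have JE a u y : S u -> S y ->
    J (a *: y + u) = J u + a * (dot y u - ell y) + a ^+ 2 * `|y| ^+ 2 / 2.
  move=> Su Sy; rewrite /J ell_lin// ip_norm_sqrD normrZ exprMn.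
  by rewrite real_normK ?num_real// ipZl; field.
have [lb lbJ] : exists lb, forall v, S v -> lb <= J v.
  exists (- (C ^+ 2 / 2)) => v Sv.
  have h1 := ellC _ Sv; have h2 := ler_norm (ell v).
  rewrite /J; have := sqr_ge0 (`|v| - C); nra.
pose A := J @` S.
have infA : has_inf A.
  by split; [exists (J 0); exists 0|exists lb => _ [v Sv <-]; exact: lbJ].
have vex n : exists v, S v /\ J v < inf A + n.+1%:R^-1.
  have [|_ [v Sv <-] h] := @inf_adherent _ A n.+1%:R^-1 _ infA;
    first by rewrite invr_gt0.
  by exists v.
have [v vP] := choice vex.
have infle u : S u -> inf A <= J u.
  by move=> Su; apply: ge_inf; [by case: infA|exists u].
have vB m n : `|v m - v n| ^+ 2 <= 4 * (m.+1%:R^-1 + n.+1%:R^-1).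
  have [Sm Jm] := vP m; have [Sn Jn] := vP n.
  have Sd : S (v m - v n) by rewrite addrC -scaleN1r; exact: Slin.
  have JE2 := JE (2^-1) _ _ Sn Sd; have := JE 1 _ _ Sn Sd.
  rewrite scale1r subrK => JE1; rewrite JE1 in Jm.
  have Sm2 : S (2^-1 *: (v m - v n) + v n) by exact: Slin.
  have := infle _ Sm2; rewrite JE2; move: Jm Jn. have -> : (2^-1 ^+ 2 : R) = 4^-1
    by field.
  rewrite expr1n; move: (m.+1%:R^-1) (n.+1%:R^-1) (inf A) (J (v n)) (dot _ _ - _)
    (`|_| ^+ 2). move=> a b i j d x; lra.
have [l vl] : exists l : V, v n @[n --> \oo] --> l.
  apply: cV => e e0.
  have e8 : 0 < e ^+ 2 / 8 by rewrite divr_gt0// exprn_gt0.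
  have [N _ NP] := near_infty_natSinv_lt (PosNum e8).
  exists N => m n Nm Nn; rewrite -(@ler_pXn2r _ 2%N) ?nnegrE//; last exact: ltW.
  apply: le_trans (vB _ _) _.
  have := NP _ Nm; have := NP _ Nn => /=.
  by move: (m.+1%:R^-1) (n.+1%:R^-1) => a b; lra.
have Sl : S l.
  apply: (@closed_cvg _ _ _ _ v S cS _ l vl); apply: nearW => n; exact: (vP n).1.
exists l => // y Sy.
(* Almost minimality of [v n] is tested at [v n] - q y with q = d / (|y|^2 + 1), where d is the
   defect to be bounded. The added 1 avoids a separate case y = 0. *)
have dn n : (dot y (v n) - ell y) ^+ 2 <= 2 * (`|y| ^+ 2 + 1) * n.+1%:R^-1.
  have [Sn Jn] := vP n.
  have Y0 : 0 < `|y| ^+ 2 + 1 by rewrite ltr_wpDl// exprn_ge0.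
  set d := dot y (v n) - ell y.
  have := infle _ (Slin (- d / (`|y| ^+ 2 + 1)) _ _ Sy Sn).
  rewrite JE// -/d mulNr; have : d = d / (`|y| ^+ 2 + 1) * (`|y| ^+ 2 + 1).
    by rewrite divfK// gt_eqF.
  move: Y0 Jn; set q := d / _; set Y := `|y| ^+ 2; set e := _^-1 => Y0 Jn dE h.
  have h2 : q ^+ 2 * (Y + 1) <= 2 * e.
    by move: h; rewrite dE sqrrN; have := sqr_ge0 q; nra.
  have -> : d ^+ 2 = (Y + 1) * (q ^+ 2 * (Y + 1)) by rewrite dE; ring.
  by apply: le_trans (ler_wpM2l (ltW Y0) h2) _; rewrite mulrCA mulrA.
have dl : (dot y (v n) - ell y) ^+ 2 @[n --> \oo] --> (dot y l - ell y) ^+ 2.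
  rewrite expr2; under eq_fun do rewrite expr2.
  have h : dot y (v n) - ell y @[n --> \oo] --> dot y l - ell y.
    by apply: cvgB (ip_cvgr vl) (cvg_cst _).
  exact: (cvgM h h).
have h0 : 2 * (`|y| ^+ 2 + 1) * n.+1%:R^-1 @[n --> \oo] --> (0 : R).
  rewrite -(mulr0 (2 * (`|y| ^+ 2 + 1))); apply: cvgMr; exact: cvg_harmonic.
have /eqP : (dot y l - ell y) ^+ 2 = 0.
  apply/eqP; rewrite eq_le sqr_ge0 andbT.
  by apply: ler_cvg_to dl h0 _; exact: nearW.
by rewrite sqrf_eq0 subr_eq0 => /eqP.
Qed.

Lemma is_derive_ip (u v : R -> V) (t : R) a b :
  is_derive t 1 u a -> is_derive t 1 v b ->
  is_derive t 1 (fun s => dot (u s) (v s)) (dot a (v t) + dot (u t) b).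
Proof.
move=> ua vb; apply/is_derive_cvgP.
have uc : u (h + t) @[h --> 0^'] --> u t.
  apply: cvg_within_filter; rewrite -[X in X --> _]/((u \o shift t) @ 0).
  by rewrite cvg_comp_shift add0r; exact: is_derive_continuous ua.
have -> : (fun h => h^-1 *: (dot (u (h + t)) (v (h + t)) - dot (u t) (v t))) =
    (fun h => dot (h^-1 *: (u (h + t) - u t)) (v t) +
              dot (u (h + t)) (h^-1 *: (v (h + t) - v t))).
  apply/funext => h; rewrite ipZl ipZr ipBl ipBr -mulrDr.
  by congr (_ * _); ring.
apply: cvgD; first by apply: ip_cvgl; exact: ((is_derive_cvgP _ _ _).1 ua).
exact: (ip_cvg uc ((is_derive_cvgP _ _ _).1 vb)).
Qed.

Lemma is_derive_ipl (z : R -> V) (t : R) v w :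
  is_derive t 1 z v -> is_derive t 1 (fun s => dot (z s) w) (dot v w).
Proof.
move=> zv; have := is_derive_ip zv (is_derive_cst w t 1).
by rewrite (ip_sym ip (z t)) ip0l addr0.
Qed.

(** With y = z b - z a, the scalar function <z, y> - |y| g has a nonpositive derivative; comparing
    its end values and dividing by |y| gives the bound. The function [g] stands for the integral of
    |dz|. *)
Lemma norm_le_increment (z dz : R -> V) (g dg : R -> R) (a b : R) : a <= b ->
  (forall t, t \in `]a, b[%R -> is_derive t 1 z (dz t)) ->
  {within `[a, b], continuous z} ->
  (forall t, t \in `]a, b[%R -> is_derive t 1 g (dg t)) ->
  {within `[a, b], continuous g} ->
  (forall t, t \in `]a, b[%R -> `|dz t| <= dg t) ->
  `|z b - z a| <= g b - g a.
Proof.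
rewrite le_eqVlt => /predU1P[->|ab]; first by move=> *; rewrite !subrr normr0.
move=> dzP cz dgP cg dzg; pose y := z b - z a.
have [y0|y0] := eqVneq y 0.
  have [c cab ->] := MVT ab dgP cg.
  by rewrite -/y y0 normr0 mulr_ge0 ?subr_ge0 ?(ltW ab)// (le_trans _ (dzg _ cab)).
pose phi t := dot (z t) y - `|y| * g t.
have dphi t : t \in `]a, b[%R -> is_derive t 1 phi (dot (dz t) y - `|y| * dg t).
  move=> tab; have h1 := is_derive_ipl y (dzP t tab); have h2 := dgP t tab.
  exact: is_deriveB.
have cphi : {within `[a, b], continuous phi}.
  by move=> x; apply: cvgB; [apply: ip_cvgl; exact: cz|apply: cvgMr; exact: cg].
have [c cab] := MVT ab dphi cphi.
have : (dot (dz c) y - `|y| * dg c) * (b - a) <= 0.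
  rewrite mulr_le0_ge0 ?subr_ge0 ?(ltW ab)// subr_le0.
  by apply: le_trans (ip_le _ _) _; rewrite mulrC ler_wpM2l// dzg.
move=> /[swap] <-; rewrite /phi => h.
have : `|y| ^+ 2 <= `|y| * (g b - g a).
  by rewrite -(ip_norm ip) {1}/y ipBl; move: h; lra.
by rewrite expr2 ler_pM2l// normr_gt0.
Qed.

(** The function |y - z|^2 exp(- 2 L t) has a nonpositive derivative and vanishes at 0. Derivatives
    are required only inside the interval, which accommodates one-sided derivatives at the ends. *)
Lemma gronwall_unique (y z dy dz : R -> V) (L T : R) : 0 <= T ->
  (forall t, t \in `]0, T[%R -> is_derive t 1 y (dy t)) ->
  (forall t, t \in `]0, T[%R -> is_derive t 1 z (dz t)) ->
  {within `[0, T], continuous y} -> {within `[0, T], continuous z} ->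
  (forall t, t \in `]0, T[%R -> `|dy t - dz t| <= L * `|y t - z t|) ->
  y 0 = z 0 -> y T = z T.
Proof.
rewrite le_eqVlt => /predU1P[<-//|T0] dyP dzP cy cz LP yz0.
pose d t := y t - z t.
pose phi t := dot (d t) (d t) * expR (- (2 * L) * t).
pose dphi t := (2 * dot (dy t - dz t) (d t) - 2 * L * dot (d t) (d t)) *
  expR (- (2 * L) * t).
have dphiP t : t \in `]0, T[%R -> is_derive t 1 phi (dphi t).
  move=> tT; have h1 := dyP t tT; have h2 := dzP t tT.
  have h3 : is_derive t 1 d (dy t - dz t) by exact: is_deriveB.
  have h4 := is_derive_ip h3 h3.
  have h5 := is_derive_expRM (- (2 * L)) t.
  have h6 := is_deriveM h4 h5.
  apply: is_derive_eq h6 _; rewrite /dphi (ip_sym ip (d t)) /GRing.scale/=; ring.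
have cphi : {within `[0, T], continuous phi}.
  move=> x; apply: cvgM.
    by apply: ip_cvg; apply: cvgB; [exact: cy|exact: cz|exact: cy|exact: cz].
  apply: continuous_subspaceT => t.
  exact: is_derive_continuous (is_derive_expRM _ t).
have [c cT] := MVT T0 dphiP cphi.
have : dphi c * (T - 0) <= 0.
  rewrite subr0 mulr_le0_ge0 ?(ltW T0)// mulr_le0_ge0 ?expR_ge0// (ip_norm ip).
  have := ip_le (dy c - dz c) (d c); have := LP c cT; rewrite -/(d c).
  have := normr_ge0 (d c); nra.
move=> /[swap] <-; rewrite /phi [d 0]/d yz0 subrr ip0l mul0r subr0.
rewrite pmulr_lle0 ?expR_gt0// (ip_norm ip) => h.
apply/eqP; rewrite -subr_eq0 -normr_eq0 -sqrf_eq0 eq_le h /=.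
exact: sqr_ge0.
Qed.

Lemma bounded_on_segment (f : R -> V) (a b : R) :
  {within `[a, b], continuous f} ->
  exists M, forall t, a <= t <= b -> `|f t| <= M.
Proof.
have [ab|ba] := leP a b; last first.
  by move=> _; exists 0 => t /andP[at_ tb]; have := lt_le_trans ba (le_trans at_ tb);
    rewrite ltxx.
move=> cf; have [|c _ cP] := @EVT_max R (fun t => `|f t|) a b ab.
  by move=> x; apply: cvg_norm; exact: cf.
by exists `|f c| => t tab; apply: cP; rewrite in_itv.
Qed.

(* The primitive is obtained weakly: Riesz represents w |-> int_0^t <f, w>. *)
Lemma primitive (f : R -> V) : cauchy_complete -> continuous f ->
  exists I : R -> V, I 0 = 0 /\ forall t : R, -1 < t -> is_derive t 1 I (f t).
Proof.
move=> cV cf.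
have pex w : exists p : R -> R, p 0 = 0 /\ forall t : R,
  -1 < t -> is_derive t 1 p (dot (f t) w).
  by apply: real_primitive; [move=> x; apply: ip_cvgl; exact: cf|exact: ltrN10].
have {pex} [p pP] := choice pex.
have p0 w : p w 0 = 0 by exact: (pP w).1.
have dp w (t : R) : -1 < t -> is_derive t 1 (p w) (dot (f t) w) by exact: (pP w).2.
have plin a u v (t : R) : -1 < t -> p (a *: u + v) t = a * p u t + p v t.
  move=> t1; pose q := p (a *: u + v) - (a *: p u + p v).
  have qP (x : R) : -1 < x -> is_derive x 1 q 0.
    move=> x1; have h1 := dp u x x1; have h2 := dp v x x1;
      have h3 := dp (a *: u + v) x x1.
    apply: is_derive_eq (is_deriveB h3 (is_deriveD (is_deriveZ a h1) h2)) _.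
    by rewrite ipDr ipZr subrr.
  have [x [_ _]] := mvt_between t1 (ltrN10 R) qP.
  rewrite mul0r => /eqP; rewrite subr_eq0 => /eqP.
  rewrite /q /GRing.scale /=; move=> /eqP; rewrite -[X in X == _]/(p (a *: u + v) t -
    (a * p u t + p v t)).
  rewrite -[X in _ == X]/(p (a *: u + v) 0 - (a * p u 0 + p v 0)) !p0 mulr0 addr0 subr0.
  by rewrite subr_eq0 => /eqP.
have Iex (t : R) : exists I : V, -1 < t -> forall w, dot w I = p w t.
  have [t1|t1] := ltP (-1) t; last by exists 0.
  have [M MP] := @bounded_on_segment f (- (1 + `|t|)) (1 + `|t|)
    (continuous_subspaceT cf).
  have [|||||I _ IP] := @riesz setT (fun w => p w t) (M * `|t|) cV.
  - exact: closedT.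
  - by [].
  - by [].
  - by move=> a u v _ _; exact: plin.
  - move=> w _; have [x [x1 xt E]] := mvt_between t1 (ltrN10 R) (dp w).
    move: E; rewrite p0 !subr0 in xt * => ->; rewrite normrM mulrAC ler_wpM2r//.
    apply: le_trans (ip_cauchy_schwarz _ _) _; rewrite ler_wpM2r// MP//.
    by rewrite -ler_norml (le_trans xt)// lerDr.
  - by exists I => _ w; exact: IP.
have {Iex} [I IP] := choice Iex.
exists I; split.
  by apply: ip_inj => w; rewrite ip0l (ip_sym ip) IP ?p0// ltrN10.
move=> t t1; apply/is_derive_cvgP/cvgrPdist_le => e e0.
have fe : \forall x \near t, `|f t - f x| <= e.
  exact: (cvgrPdist_le _ _).1 (cf t) e e0.
have ge1 : \forall x \near t, -1 < x by exact: lt_nbhsr.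
have : nbhs t [set x | `|f t - f x| <= e /\ -1 < x] by exact: filterI fe ge1.
move=> /nbhs_ballP[d /= d0 dP].
near=> h.
have h0 : h != 0 by near: h; exact: nbhs_dnbhs_neq.
have hd : `|h| < d by near: h; exact: dnbhs0_lt.
have dP' x : `|x - t| <= `|h| -> `|f t - f x| <= e /\ -1 < x.
  by move=> xh; apply: dP; rewrite /ball/= distrC; exact: le_lt_trans hd.
have ht1 : -1 < h + t by apply: (dP' _ _).2; rewrite addrK.
(* The remainder [y] is itself taken as the test vector: the scalar mean value theorem then gives
   |y|^2 = <f t - f x, y>, where [x] depends on [y] but is no farther from [t] than [h + t]. *)
set y := f t - _.
have [x [_ xt E]] := mvt_between ht1 t1 (dp y).
have {}xt : `|f t - f x| <= e by apply: (dP' _ _).1; move: xt; rewrite addrK.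
have : `|y| ^+ 2 <= e * `|y|.
  rewrite -(ip_norm ip) {1}/y ipBl ipZl ipBl.
  rewrite !(ip_sym ip (I _)) !IP// E addrK (mulrC _ h) mulKf// -ipBl.
  by apply: le_trans (ip_le _ _) _; apply: ler_wpM2r.
have [->|y0] := eqVneq y 0; first by move=> _; rewrite normr0 ltW.
by rewrite expr2 ler_pM2r// normr_gt0.
Unshelve. all: by end_near. Qed.

Lemma geometric_cvg (u : nat -> V) (M : R) : cauchy_complete ->
  (forall n, `|u n.+1 - u n| <= M / 2 ^+ n) ->
  exists l : V, u n @[n --> \oo] --> l /\ forall n, `|l - u n| <= 2 * M / 2 ^+ n.
Proof.
move=> cV uM.
have M0 : 0 <= M by have := uM 0%N; rewrite expr0 divr1; exact: le_trans.
have p2 n : 0 < 2 ^+ n :> R by rewrite exprn_gt0.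
have b0 n : 0 <= 2 * M / 2 ^+ n by rewrite divr_ge0 ?mulr_ge0// ltW.
have tele k n : `|u (n + k)%N - u n| <= 2 * M / 2 ^+ n - 2 * M / 2 ^+ (n + k).
  elim: k => [|k IH]; first by rewrite addn0 !subrr normr0.
  rewrite addnS; have -> : u (n + k).+1 - u n = (u (n + k).+1 - u (n + k)%N) + (u (n
    + k)%N - u n).
    by rewrite addrA subrK.
  apply: le_trans (ler_normD _ _) _; apply: le_trans (lerD (uM _) IH) _.
  rewrite le_eqVlt; apply/orP; left; apply/eqP; rewrite exprS; field.
  by rewrite !gt_eqF.
have dist m n : (n <= m)%N -> `|u m - u n| <= 2 * M / 2 ^+ n.
  by move=> nm; rewrite -(subnKC nm); apply: le_trans (tele _ _) _; rewrite gerBl.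
have [l ul] : exists l : V, u n @[n --> \oo] --> l.
  apply: cV => e e0.
  have [N NP] := geometric_small (divr_gt0 e0 (ltr0n _ 2)) (mulr_ge0 (ler0n _ 2) M0).
  exists N => m n Nm Nn; have -> : u m - u n = (u m - u N) - (u n - u N).
    by rewrite opprB addrA subrK.
  have h1 := le_trans (dist _ _ Nm) (NP _ (leqnn _)).
  have h2 := le_trans (dist _ _ Nn) (NP _ (leqnn _)).
  by apply: le_trans (ler_normB _ _) _; apply: le_trans (lerD h1 h2) _; rewrite -splitr.
exists l; split=> // n.
have h : `|u m - u n| @[m --> \oo] --> `|l - u n|.
  by apply: cvg_norm; apply: cvgB => //; exact: cvg_cst.
apply: (ler_cvg_to h (cvg_cst _)).
by exists n => // m /= nm; exact: dist.
Qed.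

(** Lipschitz constants uniform on each [0, T] suffice for a global solution, because the iterates
    are compared in a norm with exponential weight. Continuity of [F] is asked along curves, which
    is the form used to integrate t |-> F t (z t). *)
Lemma picard (F : R -> V -> V) (w0 : V) : cauchy_complete ->
  (forall T : R, exists L : R, forall (t : R) a b, 0 <= t <= T ->
    `|F t a - F t b| <= L * `|a - b|) ->
  (forall z : R -> V, continuous z -> continuous (fun t => F t (z t))) ->
  exists z : R -> V, z 0 = w0 /\ forall t : R, 0 <= t -> is_derive t 1 z (F t (z t)).
Proof.
move=> cV Flip Fcont.
(* The integration operator has to be total to be chosen; for a discontinuous [f] its value carries
   no information. *)
have Jex (f : R -> V) : exists I : R -> V, continuous f ->
    I 0 = w0 /\ forall t : R, 0 <= t -> is_derive t 1 I (f t).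
  have [cf|] := pselect (continuous f); last by exists f.
  have [I [I0 IP]] := primitive cV cf.
  exists (fun t => w0 + I t) => _; split=> [|t t0]; first by rewrite I0 addr0.
  have h := IP t (lt_le_trans (ltrN10 R) t0); have h2 := is_derive_cst w0 t (1 : R).
  by have := is_deriveD h2 h; rewrite add0r.
have {Jex} [J JP] := choice Jex.
(* Curves are only controlled at times t >= 0 and are frozen before. *)
pose c (s : R) : R := Num.max s 0.
have c0 s : 0 <= c s by rewrite /c le_max lexx orbT.
have cid s : 0 <= s -> c s = s by move=> s0; rewrite /c; exact/max_idPl.
have cc : continuous c.
  by move=> s; apply: (@continuous_max _ _ (fun x : R => x) (fun=> 0));
    [exact: cvg_id|exact: cvg_cst].
pose step (z : R -> V) := J (fun s => F s (z (c s))).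
have stepP (z : R -> V) : continuous (z \o c) -> step z 0 = w0 /\
    forall t : R, 0 <= t -> is_derive t 1 (step z) (F t (z t)).
  move=> /Fcont/JP[J0 JD]; split=> // t t0; have /= := JD t t0.
  by rewrite cid.
have derc (z dz : R -> V) : (forall t : R, 0 <= t -> is_derive t 1 z (dz t)) ->
    continuous (z \o c).
  move=> zd t; apply: continuous_comp; first exact: cc.
  exact: is_derive_continuous (zd _ (c0 t)).
pose z n := iter n step (cst w0).
have zc n : continuous (z n \o c).
  elim: n => [|n IH]; first by move=> t; exact: cvg_cst.
  exact: derc (stepP _ IH).2.
have z0 n : z n 0 = w0 by case: n => [|n] //; exact: (stepP _ (zc n)).1.
have zd n (t : R) : 0 <= t -> is_derive t 1 (z n.+1) (F t (z n t)).
  exact: (stepP _ (zc n)).2.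
have withinc (u : R -> V) t : continuous (u \o c) -> {within `[0, t], continuous u}.
  move=> uc; apply: (@subspace_eq_continuous _ _ _ (u \o c)).
    by move=> s; rewrite inE/= in_itv/= => /andP[s0 _]; rewrite /from_subspace/= cid.
  exact: continuous_subspaceT.
have expc (k : R) (t : R) : {within `[0, t], continuous (fun s => expR (k * s))}.
  apply: continuous_subspaceT => s.
  exact: is_derive_continuous (is_derive_expRM _ s).
have est (T : R) : 0 <= T -> exists M L : R, [/\ 0 <= M, 0 <= L,
    (forall (t : R) a b, 0 <= t <= T -> `|F t a - F t b| <= L * `|a - b|) &
    forall n (t : R), 0 <= t <= T -> `|z n.+1 t - z n t| <= M / 2 ^+ n].
  move=> T0; have [L0 L0P] := Flip T; pose L := Num.max L0 1.
  have Lp : 0 < L by rewrite /L lt_max ltr01 orbT.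
  have LP t a b : 0 <= t <= T -> `|F t a - F t b| <= L * `|a - b|.
    by move=> /(L0P _ a b) h; apply: le_trans h _; rewrite ler_wpM2r// /L le_max lexx.
  have [B0 B0P] : exists M, forall t, 0 <= t <= T -> `|z 1%N t - z 0%N t| <= M.
    by apply: bounded_on_segment; apply: withinc => t; apply: cvgB; exact: zc.
  pose B := Num.max B0 0.
  have B0' : 0 <= B by rewrite /B le_max lexx orbT.
  (* The derivative of exp(2 L t) is 2 L times itself, so integrating L times the previous bound
     gains a factor 1/2, on all of [0, T] at once. *)
  have BP n t : 0 <= t <= T -> `|z n.+1 t - z n t| <= B / 2 ^+ n * expR (2 * L * t).
    elim: n t => [|n IH] t /andP[t0 tT].
      rewrite expr0 divr1; apply: (@le_trans _ _ B).
        by rewrite /B le_max B0P ?t0.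
      rewrite ler_peMr// -expR0 ler_expR mulr_ge0// mulr_ge0// ltW//.
    have h := @norm_le_increment (z n.+2 - z n.+1) (fun s =>
      F s (z n.+1 s) - F s (z n s))
      (fun s => B / 2 ^+ n.+1 * expR (2 * L * s))
      (fun s => B / 2 ^+ n.+1 * (expR (2 * L * s) * (2 * L))) 0 t t0 _ _ _ _ _.
    apply: le_trans (le_trans (h _ _ _ _ _) _).
    - rewrite -[(z n.+2 - z n.+1) t]/(z n.+2 t - z n.+1 t).
      by rewrite -[(z n.+2 - z n.+1) 0]/(z n.+2 0 - z n.+1 0) !z0 subrr subr0.
    - move=> s; rewrite in_itv/= => /andP[s0 _].
      exact: (is_deriveB (zd n.+1 s (ltW s0)) (zd n s (ltW s0))).
    - apply: withinc => s; apply: cvgB; exact: zc.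
    - move=> s _; apply: is_deriveZ; exact: is_derive_expRM.
    - by move=> s; apply: cvgMr; exact: expc.
    - move=> s; rewrite in_itv/= => /andP[s0 st].
      have sT : 0 <= s <= T by rewrite (ltW s0) (le_trans (ltW st)).
      apply: le_trans (LP _ _ _ sT) _; apply: le_trans (ler_wpM2l (ltW Lp) (IH _ sT)) _.
      rewrite le_eqVlt; apply/orP; left; apply/eqP; rewrite exprS; field.
      by rewrite expf_neq0.
    - by rewrite lerBlDr lerDl mulr_ge0 ?expR_ge0// divr_ge0.
  exists (B * expR (2 * L * T)), L; split => //; first by rewrite mulr_ge0// expR_ge0.
    exact: ltW.
  move=> n t tT; apply: le_trans (BP n t tT) _.
  rewrite mulrAC ler_wpM2r ?invr_ge0 ?exprn_ge0// ler_wpM2l// ler_expR ler_wpM2l//.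
    by rewrite mulr_ge0// ltW.
  by case/andP: tT.
have zlim (t : R) : exists l : V, 0 <= t -> z n t @[n --> \oo] --> l.
  have [t0|] := leP 0 t; last by exists 0.
  have [M [_ [_ _ _ zM]]] := est t t0.
  have [l [zl _]] := @geometric_cvg (fun n => z n t) M cV (fun n =>
    zM n t (introT andP (conj t0 (lexx t)))).
  by exists l.
have {zlim} [y yP] := choice zlim.
have unif (T : R) : 0 <= T -> exists M L : R, [/\ 0 <= M, 0 <= L,
    (forall (t : R) a b, 0 <= t <= T -> `|F t a - F t b| <= L * `|a - b|) &
    forall n (t : R), 0 <= t <= T -> `|y t - z n t| <= M / 2 ^+ n].
  move=> T0; have [M [L [M0 L0 LP zM]]] := est T T0.
  exists (2 * M), L; split => //; first by rewrite mulr_ge0.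
  move=> n t tT; have t0 : 0 <= t by case/andP: tT.
  have [l [zl lM]] := @geometric_cvg (fun n => z n t) M cV (fun n => zM n t tT).
  by rewrite (cvg_unique _ (yP t t0) zl)//; exact: lM.
have yc : continuous (y \o c).
  move=> t; apply/cvgrPdist_le => e e0.
  have [M [_ [M0 _ _ yM]]] := unif (c t + 1) (addr_ge0 (c0 t) ler01).
  have [n /(_ n (leqnn n)) nP] := geometric_small (divr_gt0 e0 (ltr0n _ 3)) M0.
  have near_z : \forall s \near t, `|z n (c t) - z n (c s)| <= e / 3.
    exact: (cvgrPdist_le _ _).1 (zc n t) _ (divr_gt0 e0 (ltr0n _ 3)).
  have near_c : \forall s \near t, c s <= c t + 1.
    by apply: (cvgr_le _ (cc t)); rewrite ltrDl.
  apply: filterS2 near_z near_c => s zs cs /=.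
  have h1 : `|y (c t) - z n (c t)| <= e / 3.
    by apply: le_trans (yM n (c t) _) nP; rewrite c0 lerDl ler01.
  have h2 : `|y (c s) - z n (c s)| <= e / 3.
    by apply: le_trans (yM n (c s) _) nP; rewrite c0 cs.
  have -> : y (c t) - y (c s) = (y (c t) - z n (c t)) +
      (z n (c t) - z n (c s)) - (y (c s) - z n (c s)).
    by rewrite subrKA opprB addrA subrK.
  apply: le_trans (ler_normB _ _) _.
  apply: le_trans (lerD (le_trans (ler_normD _ _) (lerD h1 zs)) h2) _.
  by rewrite le_eqVlt; apply/orP; left; apply/eqP; field.
(* The limit [y] is only known to be continuous. Its image [step y] has a derivative by
   construction, and it remains to see that the two agree for t >= 0. *)
have [u0 uD] := stepP _ yc.
have uc := derc _ _ uD.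
have uy (t : R) : 0 <= t -> step y t = y t.
  move=> t0; have [M [L [M0 L0 LP yM]]] := unif t t0.
  apply/eqP; rewrite -subr_eq0 -normr_le0; apply/ler_addgt0Pr => e e0; rewrite add0r.
  have M1 : 0 <= M + L * M * t by rewrite addr_ge0// !mulr_ge0.
  have [n /(_ n (leqnn n)) nP] := geometric_small e0 M1.
  have p2 m : 0 < 2 ^+ m :> R by rewrite exprn_gt0.
  have h1 : `|y t - z n.+1 t| <= M / 2 ^+ n.
    apply: le_trans (yM _ _ _) _; first by rewrite t0 lexx.
    by rewrite ler_wpM2l// lef_pV2 ?posrE// ler_eXn2l ?ltr1n.
  have h2 : `|(step y - z n.+1) t - (step y - z n.+1) 0| <= L * (M / 2 ^+ n) * t - L
    * (M / 2 ^+ n) * 0.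
    apply: (@norm_le_increment _ (fun s => F s (y s) - F s (z n s))
       (fun s => L * (M / 2 ^+ n) * s) (fun=> L * (M / 2 ^+ n)) 0 t t0).
    - move=> s; rewrite in_itv/= => /andP[s0 _].
      exact: (is_deriveB (uD s (ltW s0)) (zd n s (ltW s0))).
    - apply: withinc => s; apply: cvgB; [exact: uc|exact: zc].
    - move=> s _; have := is_deriveZ (L * (M / 2 ^+ n)) (is_derive_id s (1 : R)).
      by move=> h; apply: is_derive_eq h _; rewrite [_ *: _]mulr1.
    - by apply: continuous_subspaceT => s; apply: cvgMr; exact: cvg_id.
    - move=> s; rewrite in_itv/= => /andP[s0 st].
      have sT : 0 <= s <= t by rewrite (ltW s0) (ltW st).
      by apply: le_trans (LP _ _ _ sT) _; rewrite ler_wpM2l// yM.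
  move: h2; rewrite -[(step y - z n.+1) t]/(step y t - z n.+1 t).
  rewrite -[(step y - z n.+1) 0]/(step y 0 - z n.+1 0) u0 z0 subrr !subr0 mulr0 subr0
    => h2.
  have -> : step y t - y t = (step y t - z n.+1 t) - (y t - z n.+1 t).
    by rewrite opprB addrA subrK.
  apply: le_trans (ler_normB _ _) _; apply: le_trans (lerD h2 h1) _.
  apply: le_trans nP; rewrite le_eqVlt; apply/orP; left; apply/eqP; field.
  by rewrite gt_eqF.
(* The witness is [step y] and not [y]: the derivative at t = 0 is two-sided, while [y] is arbitrary
   at negative times. *)
exists (step y); split => // t t0; rewrite uy//; exact: uD.
Qed.

(** * Gradient flows of a nonnegative energy in a Hilbert space *)

Section gradient_flow.
Variables (G : V -> V) (e : V -> R).
Hypothesis G_lip : forall r : R, exists L : R, forall a b, `|a| <= r -> `|b| <= r ->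
  `|G a - G b| <= L * `|a - b|.
Hypothesis e_ge0 : forall a, 0 <= e a.
Hypothesis e_diff : forall a, differentiable e a.
Hypothesis e_dec : forall a, 'd e a (G a) = - `|G a| ^+ 2.

(* With chi = 1 this is the energy estimate of the flow; it survives the
   truncation of G because chi^2 <= chi. *)
Lemma energy_displacement (z : R -> V) (chi : R -> R) (T : R) : 0 <= T ->
  (forall t, 0 <= chi t <= 1) ->
  (forall t, t \in `]0, T[%R -> is_derive t 1 z (chi t *: G (z t))) ->
  {within `[0, T], continuous z} ->
  `|z T - z 0| ^+ 2 <= T * e (z 0).
Proof.
rewrite le_eqVlt => /predU1P[<- _ _ _|T0 chi01 zd zc].
  by rewrite subrr normr0 expr0n mul0r.
pose y := z T - z 0.
pose k := `|y| ^+ 2 / (2 * T).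
(* By Young's inequality <G, y> <= (T / 2) |G|^2 + |y|^2 / (2 T), so the derivative of [phi] is at
   most (chi - 1) k <= 0. Since k T = |y|^2 / 2, comparing [phi] at 0 and at [T] gives |y|^2 / 2 <=
   (T / 2) (e (z 0) - e (z T)). *)
pose phi (s : R) := dot (z s) y + (T / 2) * e (z s) - k * s.
pose dphi (s : R) := dot (chi s *: G (z s)) y + (T / 2) * 'd e (z s)
  (chi s *: G (z s)) - k.
have phiD s : s \in `]0, T[%R -> is_derive s 1 phi (dphi s).
  move=> sT; have h := zd s sT.
  have h1 := is_derive_ip h (is_derive_cst y s (1 : R)).
  have h2 := is_deriveZ (T / 2) (is_derive_diff_comp (@e_diff (z s)) h).
  have h3 := is_deriveZ k (is_derive_id s (1 : R)).
  apply: is_derive_eq (is_deriveB (is_deriveD h1 h2) h3) _.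
  by rewrite (ip_sym ip (z s)) ip0l addr0 /dphi [k *: _]mulr1.
have phic : {within `[0, T], continuous phi}.
  move=> x; apply: cvgB; first apply: cvgD.
  - by apply: ip_cvgl; exact: zc.
  - apply: cvgMr; apply: (@cvg_comp _ _ _ z e _ (nbhs (z x))); first exact: zc.
    exact: differentiable_continuous (@e_diff (z x)).
  - apply: cvgMr; apply: (@continuous_subspaceT _ _ _ (fun s => s)) => ?; exact: cvg_id.
have [c cT] := MVT T0 phiD phic.
have /andP[c0 c1] := chi01 c.
have : dphi c * (T - 0) <= 0.
  rewrite subr0 mulr_le0_ge0 ?(ltW T0)// /dphi linearZ e_dec ipZl.
  have := ip_le (G (z c)) y; rewrite /k /GRing.scale/=.
  move: (dot (G (z c)) y) (`|G (z c)|) (`|y|) (chi c) c0 c1 => d g w x x0 x1 dgw.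
  have : g * w <= T / 2 * g ^+ 2 + w ^+ 2 / (2 * T).
    rewrite -subr_ge0; have -> : T / 2 * g ^+ 2 + w ^+ 2 / (2 * T) - g * w = (T * g -
      w) ^+ 2 / (2 * T).
      by field; rewrite gt_eqF.
    by rewrite divr_ge0 ?sqr_ge0// mulr_ge0// ltW.
  have : 0 <= w ^+ 2 / (2 * T) by rewrite divr_ge0 ?sqr_ge0// mulr_ge0// ltW.
  move: (w ^+ 2 / (2 * T)) => m m0 h.
  have h1 := ler_wpM2l x0 (le_trans dgw h).
  have h2 : x * m <= m by rewrite ler_piMl.
  rewrite mulrDr in h1; rewrite -[x *: _]/(x * - g ^+ 2)
    (_ : T / 2 * (x * - g ^+ 2) = - (x * (T / 2 * g ^+ 2))); last by ring.
  by move: h1 h2; lra.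
move=> /[swap] <-; rewrite /phi /k mulr0 subr0 => h.
have yE : dot (z T) y - dot (z 0) y = `|y| ^+ 2 by rewrite -ipBl (ip_norm ip).
have := e_ge0 (z T); move: h yE; rewrite -/y.
have -> : `|y| ^+ 2 / (2 * T) * T = `|y| ^+ 2 / 2 by field; rewrite gt_eqF.
move: (dot (z T) y) (dot (z 0) y) (e (z T)) (e (z 0)) (`|y| ^+ 2) => a b u v w; nra.
Qed.

Lemma G_continuous : continuous G.
Proof.
move=> a; have [L LP] := G_lip (`|a| + 1).
apply: (@lipschitz_at_continuous _ _ _ _ _ 1 L) => // b ab; apply: LP.
  by rewrite lerDl.
have -> : b = a - (a - b) by rewrite opprB addrC subrK.
by apply: le_trans (ler_normB _ _) _; rewrite lerD2l.
Qed.

Lemma gradient_flow_exists (w0 : V) : cauchy_complete ->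
  exists z : R -> V, z 0 = w0 /\ forall t : R, 0 <= t -> is_derive t 1 z (G (z t)).
Proof.
move=> cV.
(* The displacement estimate gives |z t - w0|^2 <= t e(w0) <= (t + e(w0))^2. On the solution the
   argument of the clamp is therefore at least 2, and the cut-off equals 1. *)
pose chi (t : R) a := clamp01 (2 + t + e w0 - `|a - w0|).
pose F t a := chi t a *: G a.
have Flip (T : R) : exists L : R, forall (t : R) a b, 0 <= t <= T ->
    `|F t a - F t b| <= L * `|a - b|.
  (* Outside the ball of radius [r] about 0 the cut-off vanishes at all times t <= T. *)
  pose r := `|w0| + (2 + T + e w0).
  have [L0 L0P] := G_lip r; pose L := Num.max L0 0.
  have L_ge0 : 0 <= L by rewrite /L le_max lexx orbT.
  have LP a b : `|a| <= r -> `|b| <= r -> `|G a - G b| <= L * `|a - b|.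
    move=> ar br; apply: le_trans (L0P _ _ ar br) _.
    by rewrite ler_wpM2r// /L le_max lexx.
  pose B := `|G 0| + L * `|r|.
  have BP a : `|a| <= r -> `|G a| <= B.
    move=> ar; have r0 : 0 <= r by exact: le_trans ar.
    have -> : G a = G 0 + (G a - G 0) by rewrite addrC subrK.
    apply: le_trans (ler_normD _ _) _; rewrite lerD2l.
    apply: le_trans (LP _ _ ar _) _; first by rewrite normr0.
    by rewrite subr0 ler_wpM2l// (ger0_norm r0).
  have chi0 t a : 0 <= t <= T -> r < `|a| -> chi t a = 0.
    move=> /andP[_ tT] ra; apply: clamp01_eq0; rewrite subr_le0.
    have : `|a| <= `|a - w0| + `|w0| by rewrite -{1}(subrK w0 a) ler_normD.
    by move: ra; rewrite /r; lra.
  (* Product of a bounded Lipschitz field and a 1-Lipschitz cut-off. Only [a] is assumed to lie in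
     the ball: if [b] lies outside, its term is zero and the variation of the cut-off alone accounts
     for the difference. *)
  have key t a b : 0 <= t <= T -> `|a| <= r -> `|F t a - F t b| <= (B + L) * `|a - b|.
    move=> tT ar.
    have chil : `|chi t a - chi t b| * `|G a| <= B * `|a - b|.
      rewrite mulrC; apply: ler_pM => //; first exact: BP.
      apply: le_trans (clamp01_lip _ _) _.
      rewrite opprB addrC addrA subrK.
      by apply: le_trans (ler_dist_dist _ _) _; rewrite opprB addrA subrK distrC.
    have [br|rb] := leP `|b| r.
      have -> : F t a - F t b = (chi t a - chi t b) *: G a + chi t b *: (G a - G b).
        by rewrite /F scalerBl scalerBr addrA subrK.
      apply: le_trans (ler_normD _ _) _; rewrite mulrDl !normrZ lerD//.
      rewrite ger0_norm ?clamp01_ge0//; apply: le_trans (LP _ _ ar br).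
      by rewrite ler_piMl// clamp01_le1.
    have -> : F t a - F t b = (chi t a - chi t b) *: G a.
      by rewrite /F (chi0 t b)// scale0r !subr0.
    rewrite normrZ; apply: le_trans chil _; rewrite ler_wpM2r// lerDl//.
  exists (B + L) => t a b tT.
  have [ar|ra] := leP `|a| r; first exact: key.
  have [br|rb] := leP `|b| r.
    by rewrite distrC [X in _ * X]distrC; exact: key.
  have B0 : 0 <= B by rewrite addr_ge0// mulr_ge0.
  by rewrite /F (chi0 t a)// (chi0 t b)// !scale0r subrr normr0 mulr_ge0// addr_ge0.
have Fcont z : continuous z -> continuous (fun t => F t (z t)).
  move=> zc t; apply: cvgZ; last by apply: (@continuous_comp _ _ _ z G);
    [exact: zc|exact: G_continuous].
  apply: (@cvg_comp _ _ _ (fun t => 2 + t + e w0 - `|z t - w0|) clamp01);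
    last exact: clamp01_continuous.
  apply: cvgB; last by apply: cvg_norm; apply: cvgB; [exact: zc|exact: cvg_cst].
  by apply: cvgD; [apply: cvgD; [exact: cvg_cst|exact: cvg_id]|exact: cvg_cst].
have [z [z0 zd]] := picard w0 cV Flip Fcont.
exists z; split => // t t0; have := zd t t0; rewrite /F /chi clamp01_eq1 ?scale1r//.
have : `|z t - z 0| ^+ 2 <= t * e (z 0).
  apply: (@energy_displacement _ (fun s => chi s (z s))) => //.
  - by move=> s; rewrite clamp01_ge0 clamp01_le1.
  - by move=> s; rewrite in_itv/= => /andP[s0 _]; apply: zd; exact: ltW.
  - apply: derivable_within_continuous => s; rewrite in_itv/= => /andP[s0 _].
    by case: (zd s s0).
rewrite z0 => h; suff : `|z t - w0| <= t + e w0 by lra.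
rewrite -(@ler_pXn2r _ 2%N) ?nnegrE ?addr_ge0//; apply: le_trans h _.
by have := e_ge0 w0; nra.
Qed.

(** The displacement estimate with cut-off 1 confines both curves to one ball about 0, on which [G]
    is Lipschitz and Gronwall's lemma applies. *)
Lemma gradient_flow_unique (y z : R -> V) (T : R) : 0 <= T ->
  (forall t, t \in `]0, T[%R -> is_derive t 1 y (G (y t))) ->
  (forall t, t \in `]0, T[%R -> is_derive t 1 z (G (z t))) ->
  {within `[0, T], continuous y} -> {within `[0, T], continuous z} ->
  y 0 = z 0 -> y T = z T.
Proof.
move=> T0 yd zd yc zc yz0.
have bound (w : R -> V) (t : R) : t \in `]0, T[%R ->
    (forall s, s \in `]0, T[%R -> is_derive s 1 w (G (w s))) ->
    {within `[0, T], continuous w} -> `|w t| <= `|w 0| + (T + e (w 0)).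
  rewrite in_itv/= => /andP[t0 tT] wd wc.
  have : `|w t - w 0| ^+ 2 <= t * e (w 0).
    apply: (@energy_displacement _ (fun=> 1)) => [|s|s|].
    - exact: ltW.
    - by rewrite ler01 lexx.
    - rewrite in_itv/= scale1r => /andP[s0 st]; apply: wd.
      by rewrite in_itv/= s0 (lt_trans st).
    - apply: continuous_subspaceW wc; apply: subset_itvl.
      by rewrite bnd_simp ltW.
  move=> h; have {}h : `|w t - w 0| <= T + e (w 0).
    rewrite -(@ler_pXn2r _ 2%N) ?nnegrE ?addr_ge0//; apply: le_trans h _.
    by have := e_ge0 (w 0); nra.
  rewrite -{1}(subrK (w 0) (w t)); apply: le_trans (ler_normD _ _) _.
  by rewrite addrC lerD2l.
have [L LP] := G_lip (`|z 0| + (T + e (z 0))).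
apply: (gronwall_unique T0 yd zd yc zc (L := L)) => // t tT.
by apply: LP; [rewrite -yz0|]; exact: bound.
Qed.
End gradient_flow.

End hilbert.

(** * Differential calculus of quartic forms *)

Section differential.
Context {R : realType}.

Context {V : normedModType R}.

(** The bound by [K] makes the candidate [D] continuous; a quadratic remainder on the unit ball
    makes it the differential, and uniqueness of the differential identifies the two. *)
Lemma diff_quadratic_remainder (E D : V -> R) (u : V) (K C : R) :
  (forall k a b, D (k *: a + b) = k * D a + D b) ->
  (forall h, `|D h| <= K * `|h|) ->
  (forall h, `|h| <= 1 -> `|E (u + h) - E u - D h| <= C * `|h| ^+ 2) ->
  differentiable E u /\ 'd E u = D :> (V -> R).
Proof.
move=> Dlin DK EC.
pose DM := GRing.isLinear.Build _ _ _ _ D Dlin.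
pose DL : {linear V -> R} := HB.pack D DM.
have DB a b : D (a - b) = D a - D b.
  by rewrite addrC -scaleN1r Dlin mulN1r addrC.
have Dc : continuous DL.
  move=> a; apply: (@lipschitz_at_continuous _ _ _ _ _ 1 K) => // b _.
  by rewrite -[_ - _]/(D a - D b) -DB.
have Eo : E \o shift u = cst (E u) + DL +o_ (0 : V) id.
  apply/eqaddoP => e e0; pose M := Num.max C 1.
  have M0 : 0 < M by rewrite /M lt_max ltr01 orbT.
  have eM : 0 < e / M by rewrite divr_gt0.
  have h1 : \forall h \near (0 : V), `|0 - h| <= e / M.
    exact: (cvgrPdist_le _ _).1 cvg_id _ eM.
  have h2 : \forall h \near (0 : V), `|0 - h| <= 1.
    exact: (cvgrPdist_le _ _).1 cvg_id _ ltr01.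
  apply: filterS2 h1 h2 => h; rewrite sub0r normrN => he /EC hC.
  rewrite -[X in `|X| <= _]/(E (h + u) - (E u + D h)) opprD addrA (addrC h u).
  apply: le_trans hC _; rewrite expr2 mulrA ler_wpM2r//.
  apply: (@le_trans _ _ (M * `|h|)); first by rewrite ler_wpM2r// /M le_max lexx.
  by rewrite mulrC -ler_pdivlMr.
have dE := diff_unique Dc Eo.
split; last exact: dE.
by apply/diff_locallyP; rewrite dE; split; [exact: Dc|exact: Eo].
Qed.

(** The three arguments are exchanged one at a time; each of the three terms is small in one slot
    and bounded by r in the two others. *)
Lemma trilinear_diff (T : V -> V -> V -> R) (K r d : R) a b c a' b' c' :
  (forall x y z w, T (x - y) z w = T x z w - T y z w) ->
  (forall x y z w, T x (y - z) w = T x y w - T x z w) ->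
  (forall x y z w, T x y (z - w) = T x y z - T x y w) ->
  (forall x y z, `|T x y z| <= K * (`|x| * `|y| * `|z|)) -> 0 <= K ->
  `|b| <= r -> `|c| <= r -> `|a'| <= r -> `|b'| <= r ->
  `|a - a'| <= d -> `|b - b'| <= d -> `|c - c'| <= d ->
  `|T a b c - T a' b' c'| <= 3 * K * r ^+ 2 * d.
Proof.
move=> T1 T2 T3 TK K0 br cr ar' br' aa bb cc.
have -> : T a b c - T a' b' c' = T (a - a') b c + T a' (b - b') c + T a' b' (c - c').
  by rewrite T1 T2 T3; ring.
have bound x y z p q s : `|x| <= p -> `|y| <= q -> `|z| <= s ->
    `|T x y z| <= K * (p * q * s).
  move=> xp yq zs; apply: le_trans (TK _ _ _) _; rewrite ler_wpM2l//.
  by rewrite ler_pM ?mulr_ge0// ler_pM.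
have -> : 3 * K * r ^+ 2 * d = K * (d * r * r) + K * (r * d * r) + K * (r * r * d)
  by ring.
apply: le_trans (ler_normD _ _) _; apply: lerD; last exact: bound.
by apply: le_trans (ler_normD _ _) _; apply: lerD; exact: bound.
Qed.

Section quartic.
Variables (Q : V -> V -> V -> V -> R) (C : R).
Hypothesis Q1 : forall k u v b c d, Q (k *: u + v) b c d = k * Q u b c d + Q v b c d.
Hypothesis Q2 : forall k u v a c d, Q a (k *: u + v) c d = k * Q a u c d + Q a v c d.
Hypothesis Q3 : forall k u v a b d, Q a b (k *: u + v) d = k * Q a b u d + Q a b v d.
Hypothesis Q4 : forall k u v a b c, Q a b c (k *: u + v) = k * Q a b c u + Q a b c v.
Hypothesis QC : forall a b c d, `|Q a b c d| <= C * (`|a| * `|b| * `|c| * `|d|).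
Hypothesis C0 : 0 <= C.

Definition quartic (u : V) : R := 2^-1 * Q u u u u.

(** The product rule over the four slots. [Q] is not assumed symmetric, so the four terms cannot be
    merged. *)
Definition dquartic (u h : V) : R :=
  2^-1 * (Q h u u u + Q u h u u + Q u u h u + Q u u u h).

Let sub1 a b c d e : Q (a - b) c d e = Q a c d e - Q b c d e.
Proof. by rewrite addrC -scaleN1r Q1 mulN1r addrC. Qed.
Let sub2 a b c d e : Q c (a - b) d e = Q c a d e - Q c b d e.
Proof. by rewrite addrC -scaleN1r Q2 mulN1r addrC. Qed.
Let sub3 a b c d e : Q c d (a - b) e = Q c d a e - Q c d b e.
Proof. by rewrite addrC -scaleN1r Q3 mulN1r addrC. Qed.
Let sub4 a b c d e : Q c d e (a - b) = Q c d e a - Q c d e b.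
Proof. by rewrite addrC -scaleN1r Q4 mulN1r addrC. Qed.

(** Freezing [h] in one of the four slots leaves a trilinear form with constant C |h|; the
    disjunction treats the four cases together. *)
Let slot_diff (T : V -> V -> V -> R) h (r d : R) u b c u' b' c' :
  [\/ T = (fun a b c => Q h a b c), T = (fun a b c => Q a h b c),
      T = (fun a b c => Q a b h c) | T = (fun a b c => Q a b c h)] ->
  `|b| <= r -> `|c| <= r -> `|u'| <= r -> `|b'| <= r ->
  `|u - u'| <= d -> `|b - b'| <= d -> `|c - c'| <= d ->
  `|T u b c - T u' b' c'| <= 3 * (C * `|h|) * r ^+ 2 * d.
Proof.
move=> TQ; apply: trilinear_diff; last by rewrite mulr_ge0.
- by case: TQ => -> *; rewrite (sub1, sub2).
- by case: TQ => -> *; rewrite (sub2, sub3).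
- by case: TQ => -> *; rewrite (sub3, sub4).
- case: TQ => -> x y z; apply: le_trans (QC _ _ _ _) _;
  by rewrite le_eqVlt; apply/orP; left; apply/eqP; ring.
Qed.

Lemma dquartic_lin u k a b :
  dquartic u (k *: a + b) = k * dquartic u a + dquartic u b.
Proof. by rewrite /dquartic Q1 Q2 Q3 Q4; ring. Qed.

Lemma dquartic_bound u h : `|dquartic u h| <= 2 * C * `|u| ^+ 3 * `|h|.
Proof.
rewrite /dquartic normrM ger0_norm ?invr_ge0// ler_pdivrMl//.
have -> : 2 * (2 * C * `|u| ^+ 3 * `|h|) = C * (`|h| * `|u| * `|u| * `|u|) +
    C * (`|u| * `|h| * `|u| * `|u|) + C * (`|u| * `|u| * `|h| * `|u|) +
    C * (`|u| * `|u| * `|u| * `|h|) by ring.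
apply: le_trans (ler_normD _ _) _; apply: lerD; last exact: QC.
apply: le_trans (ler_normD _ _) _; apply: lerD; last exact: QC.
by apply: le_trans (ler_normD _ _) _; apply: lerD; exact: QC.
Qed.

Let four_terms (x1 x2 x3 x4 y1 y2 y3 y4 z : R) :
  `|x1 - y1| <= z -> `|x2 - y2| <= z -> `|x3 - y3| <= z -> `|x4 - y4| <= z ->
  `|2^-1 * (x1 + x2 + x3 + x4) - 2^-1 * (y1 + y2 + y3 + y4)| <= 2 * z.
Proof. by rewrite !ler_norml => /andP[? ?] /andP[? ?] /andP[? ?] /andP[? ?]; lra. Qed.

(** The constant is 6 = 1/2 * 4 * 3: four slots for [h], and three remaining arguments in each
    term. *)
Lemma dquartic_lip u v h r : `|u| <= r -> `|v| <= r ->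
  `|dquartic u h - dquartic v h| <= 6 * C * r ^+ 2 * `|u - v| * `|h|.
Proof.
move=> ur vr.
have -> : 6 * C * r ^+ 2 * `|u - v| * `|h| = 2 * (3 * (C * `|h|) * r ^+ 2 * `|u - v|)
  by ring.
apply: four_terms.
- by apply: (@slot_diff (fun a b c => Q h a b c)) => //; constructor 1.
- by apply: (@slot_diff (fun a b c => Q a h b c)) => //; constructor 2.
- by apply: (@slot_diff (fun a b c => Q a b h c)) => //; constructor 3.
- by apply: (@slot_diff (fun a b c => Q a b c h)) => //; constructor 4.
Qed.

(** With w = u + h, the increment telescopes into four terms having [h] in one slot, [u] in the
    slots before it and [w] in those after it. Replacing each [w] by [u] gives [dquartic] with an
    error of order |h|^2. *)
Lemma diff_quartic u : differentiable quartic u /\ 'd quartic u = dquartic u :> (V ->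
  R).
Proof.
apply: (@diff_quadratic_remainder _ _ _ (2 * C * `|u| ^+ 3) (6 * C * (`|u| + 1) ^+ 2)).
- exact: dquartic_lin.
- exact: dquartic_bound.
move=> h h1; pose w := u + h.
have wu : w - u = h by rewrite /w addrC addKr.
have -> : quartic (u + h) - quartic u - dquartic u h =
    2^-1 * (Q h w w w + Q u h w w + Q u u h w + Q u u u h) - dquartic u h.
  have e1 := sub1 w u w w w; have e2 := sub2 w u u w w.
  have e3 := sub3 w u u u w; have e4 := sub4 w u u u u.
  rewrite wu in e1 e2 e3 e4; rewrite e1 e2 e3 e4 /quartic -/w.
  by congr (_ - _); ring.
have wr : `|w| <= `|u| + 1 by apply: le_trans (ler_normD _ _) _; rewrite lerD2l.
have ur : `|u| <= `|u| + 1 by rewrite lerDl.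
have uu : `|u - u| <= `|h| by rewrite subrr normr0.
have wuh : `|w - u| <= `|h| by rewrite wu.
have -> : 6 * C * (`|u| + 1) ^+ 2 * `|h| ^+ 2 =
    2 * (3 * (C * `|h|) * (`|u| + 1) ^+ 2 * `|h|) by ring.
apply: four_terms.
- by apply: (@slot_diff (fun a b c => Q h a b c)) => //; constructor 1.
- by apply: (@slot_diff (fun a b c => Q a h b c)) => //; constructor 2.
- by apply: (@slot_diff (fun a b c => Q a b h c)) => //; constructor 3.
- by apply: (@slot_diff (fun a b c => Q a b c h)) => //; constructor 4.
Qed.
End quartic.
End differential.

(** * Completeness of L^2 and of the Sobolev spaces *)

Section L2_theory.
Context d (T : measurableType d) (R : realType).
Variable mu : {measure set T -> \bar R}.
Local Notation L2 := (L2 mu).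

Lemma L2_measurable (u : L2) : measurable_fun setT (u : T -> R).
Proof. by have := L2_Lfun u; rewrite inE => /andP[]; rewrite inE. Qed.

Lemma L2_of_Lfun (f : T -> R) : f \in Lfun mu 2%:E ->
  exists u : L2, {ae mu, forall x, u x = f x}.
Proof.
move=> lf; exists (\pi_L2 (Lfun_Sub (@le1_2 R) lf)).
apply: filterS (L2_piE (Lfun_Sub (@le1_2 R) lf)) => x ->.
by rewrite Lfun_valP.
Qed.

Lemma Lfun2_sqr (f : T -> R) : measurable_fun setT f ->
  (\int[mu]_x ((f x ^+ 2)%:E) < +oo)%E -> f \in Lfun mu 2%:E.
Proof.
move=> mf if2; rewrite inE; apply/andP; split; first by rewrite inE.
rewrite inE /= /finite_norm unlock /Lnorm; apply: poweR_lty.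
apply: le_lt_trans if2; rewrite le_eqVlt; apply/orP; left; apply/eqP.
apply: eq_integral => x _ /=.
by rewrite powR_mulrn// real_normK ?num_real.
Qed.

Lemma L2_sqrE (u : L2) : ((L2_dot u u)%:E = \int[mu]_x ((u x) ^+ 2)%:E)%E.
Proof.
have iu := Lfun2_integrable_mul (L2_Lfun u) (L2_Lfun u).
rewrite /L2_dot /Rintegral fineK; last exact: integrable_fin_num.
by apply: eq_integral => x _; rewrite expr2.
Qed.

Lemma L2_dot_ae (u v : L2) (f g : T -> R) :
  measurable_fun setT f -> measurable_fun setT g ->
  {ae mu, forall x, u x = f x} -> {ae mu, forall x, v x = g x} ->
  L2_dot u v = \int[mu]_x (f x * g x).
Proof.
move=> mf mg uf vg; congr fine; apply: ae_eq_integral => //.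
- by apply/measurable_EFinP; apply: measurable_funM; exact: L2_measurable.
- by apply/measurable_EFinP; exact: measurable_funM.
- by apply: filterS2 uf vg => x /= -> -> _.
Qed.

Lemma L2_subE (u v : L2) : {ae mu, forall x, (u - v : L2) x = u x - v x}.
Proof.
have h := L2_linE (-1) v u.
by rewrite scaleN1r addrC in h; apply: filterS h => x ->; rewrite mulN1r addrC.
Qed.

Lemma L2_sqr_le (u : L2) (f : T -> R) (h : T -> \bar R) :
  measurable_fun setT f -> measurable_fun setT h ->
  {ae mu, forall x, u x = f x} -> (forall x, 0 <= h x)%E ->
  {ae mu, forall x, ((f x ^+ 2)%:E <= h x)%E} ->
  ((L2_dot u u)%:E <= \int[mu]_x h x)%E.
Proof.
move=> mf mh uf h0 fh; rewrite L2_sqrE; apply: ae_ge0_le_integral => //.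
- by move=> x _; rewrite lee_fin sqr_ge0.
- by apply/measurable_EFinP; apply: measurable_funX; exact: L2_measurable.
- by apply: filterS2 uf fh => x -> + _.
Qed.

Lemma L2_dot0l (w : L2) : L2_dot 0 w = 0.
Proof. by have := L2_dot_lin (-1) 0 0 w; rewrite scaler0 addr0 mulN1r addNr. Qed.

Lemma L2_dotZl a (u w : L2) : L2_dot (a *: u) w = a * L2_dot u w.
Proof. by have := L2_dot_lin a u 0 w; rewrite !addr0 L2_dot0l addr0. Qed.

Lemma L2_dotDl (u v w : L2) : L2_dot (u + v) w = L2_dot u w + L2_dot v w.
Proof. by rewrite -[u]scale1r L2_dot_lin mul1r scale1r. Qed.

Lemma L2_dotBl (u v w : L2) : L2_dot (u - v) w = L2_dot u w - L2_dot v w.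
Proof. by rewrite L2_dotDl -scaleN1r L2_dotZl mulN1r. Qed.

Lemma L2_dot_lin2 a (u v w : L2) :
  L2_dot w (a *: u + v) = a * L2_dot w u + L2_dot w v.
Proof. by rewrite !(L2_dotC w) L2_dot_lin. Qed.

Lemma L2_dotN2 (u : L2) : L2_dot (- u) (- u) = L2_dot u u.
Proof. by rewrite -scaleN1r L2_dotZl L2_dotC L2_dotZl mulrA mulrNN !mul1r. Qed.

Lemma L2_dotD2_le (u v : L2) :
  L2_dot (u + v) (u + v) <= 2 * (L2_dot u u + L2_dot v v).
Proof.
have := L2_dot_ge0 (u - v); rewrite !L2_dotBl !(L2_dotC _ (u - v)) !L2_dotBl.
rewrite !L2_dotDl !(L2_dotC _ (u + v)) !L2_dotDl (L2_dotC v u); lra.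
Qed.

Lemma L2_CS_sqr (u v : L2) : L2_dot u v ^+ 2 <= L2_dot u u * L2_dot v v.
Proof.
have [v0|v0] := eqVneq (L2_dot v v) 0.
  by rewrite (L2_dot_eq0 v0) L2_dotC !L2_dot0l expr0n/= mulr0.
have vp : 0 < L2_dot v v by rewrite lt_def v0 L2_dot_ge0.
have := L2_dot_ge0 (L2_dot v v *: u + (- L2_dot u v) *: v).
rewrite !L2_dot_lin !L2_dotZl ![L2_dot _ (_ + _)]L2_dotC !L2_dot_lin !L2_dotZl.
rewrite (L2_dotC v u); move: vp.
move: (L2_dot u u) (L2_dot v v) (L2_dot u v) => a b c b0 h.
have : 0 <= b * (a * b - c ^+ 2) by apply: le_trans h _; rewrite le_eqVlt; apply/orP;
  left; apply/eqP; ring.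
by rewrite pmulr_rge0// subr_ge0.
Qed.

Lemma realType_complete : cauchy_complete (V := R).
Proof.
move=> u uC; apply/cvg_ex/cauchy_cvgP/cauchy_exP => e e0.
have [N NP] := uC _ (divr_gt0 e0 (ltr0n _ 2)).
exists (u N); exists N => // n /= Nn; rewrite /ball/=.
by apply: le_lt_trans (NP _ _ (leqnn _) Nn) _; rewrite ltr_pdivrMr// ltr_pMr// ltr1n.
Qed.

(* Along a fast subsequence v, h = sum_k 4^k (v_(k+1) - v_k)^2 is integrable,
   and it controls both the pointwise convergence of v and the error. *)
Lemma L2_fast_cvg (v : nat -> L2) :
  (forall k, L2_dot (v k.+1 - v k) (v k.+1 - v k) <= 2^-1 / 8 ^+ k) ->
  exists l : L2, forall k, L2_dot (v k - l) (v k - l) <= 4 / 4 ^+ k.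
Proof.
move=> vfast.
pose dk k x : R := v k.+1 x - v k x.
pose h x : \bar R := (\sum_(0 <= k <oo) (4 ^+ k * dk k x ^+ 2)%:E)%E.
have t0 k x : (0 <= (4 ^+ k * dk k x ^+ 2)%:E)%E
  by rewrite lee_fin mulr_ge0 ?sqr_ge0// exprn_ge0.
have mdk k : measurable_fun setT (dk k) by apply: measurable_funB; exact: L2_measurable.
have mt k : measurable_fun setT (fun x => (4 ^+ k * dk k x ^+ 2)%:E).
  by apply/measurable_EFinP; apply: measurable_funM => //; apply: measurable_funX.
have h0 x : (0 <= h x)%E by apply: nneseries_ge0 => k _ _; exact: t0.
have mh : measurable_fun setT h.
  by apply: ge0_emeasurable_sum => // k x _ _; exact: t0.
(* The integral of the k-th term is at most 4^k * 2^-1 / 8^k = 2^-(k+1), and these bounds sum to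
   1. *)
have ih : (\int[mu]_x h x <= 1)%E.
  rewrite /h integral_nneseries//.
  apply: le_trans (epsilon_trick0 xpredT (@ler01 R)).
  apply: lee_nneseries => [k _ _|k _].
    by apply: integral_ge0 => x _; exact: t0.
  under eq_integral do rewrite EFinM.
  rewrite ge0_integralZl//; last 2 first.
  - by apply/measurable_EFinP; apply: measurable_funX.
  - by move=> x _; rewrite lee_fin sqr_ge0.
  have -> : (\int[mu]_x (dk k x ^+ 2)%:E = (L2_dot (v k.+1 - v k) (v k.+1 - v k))%:E)%E.
    rewrite L2_sqrE; apply: ae_eq_integral => //.
    - by apply/measurable_EFinP; apply: measurable_funX.
    - by apply/measurable_EFinP; apply: measurable_funX; exact: L2_measurable.
    - by apply: filterS (L2_subE (v k.+1) (v k)) => x -> _.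
  rewrite -EFinM lee_fin; apply: le_trans (ler_wpM2l _ (vfast k)) _;
    first by rewrite exprn_ge0.
  rewrite natrX exprS le_eqVlt; apply/orP; left; apply/eqP.
  have -> : 8 = 4 * 2 :> R by lra.
  by rewrite exprMn; field; rewrite !expf_neq0.
have ihfin : {ae mu, forall x, h x \is a fin_num}.
  have : mu.-integrable setT h.
    apply/integrableP; split => //.
    under eq_integral do rewrite gee0_abs//.
    by apply: le_lt_trans ih _; exact: ltry.
  by move=> /(integrable_ae measurableT); apply: filterS => x; apply.
have c0 k : 0 <= 4 / 4 ^+ k :> R by rewrite divr_ge0 ?exprn_ge0.
pose A := [set x | h x \is a fin_num].
have mA : measurable A by rewrite -[A]setTI; exact: emeasurable_fin_num.
(* Multiplying by the indicator of the set where [h] is finite makes the sequence converge at every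
   point, so that its limit is measurable. *)
pose f k x : R := v k x * \1_A x.
have mf k : measurable_fun setT (f k).
  by apply: measurable_funM; [exact: L2_measurable|exact: measurable_indic].
have flim x : exists l : R, f k x @[k --> \oo] --> l /\
    (A x -> forall k, `|l - v k x| <= 2 * Num.sqrt (fine (h x)) / 2 ^+ k).
  have [Ax|Ax] := pselect (A x); last first.
    exists 0; split => //; rewrite /f; under eq_fun do rewrite indicE memNset// mulr0.
    exact: cvg_cst.
  have [|l [vl lE]] := @geometric_cvg R R (fun k =>
    v k x) (Num.sqrt (fine (h x))) realType_complete _.
    move=> k; have hk : 4 ^+ k * dk k x ^+ 2 <= fine (h x).
      rewrite -lee_fin (fineK Ax).
      apply: le_trans (nneseries_lim_ge (P := xpredT) k.+1 (fun n _ _ => t0 n x)).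
      by rewrite big_mkord big_ord_recr/= leeDr// sume_ge0.
    have p2 : 0 < 2 ^+ k :> R by rewrite exprn_gt0.
    rewrite ler_pdivlMr// -sqrtr_sqr -(ger0_norm (ltW p2)) -sqrtr_sqr -sqrtrM
      ?sqr_ge0//.
    rewrite ler_wsqrtr// mulrC -exprM mulnC exprM.
    by have -> : 2 ^+ 2 = 4 :> R by rewrite expr2; lra.
  exists l; split => //.
  by rewrite /f; under eq_fun do rewrite indicE mem_set// mulr1.
have {flim} [g gP] := choice flim.
have mg : measurable_fun setT g.
  apply: (@measurable_fun_cvg _ _ _ _ f) => // x _; exact: (gP x).1.
have gv k : {ae mu, forall x, (((g x - v k x) ^+ 2)%:E <= (4 / 4 ^+ k)%:E * h x)%E}.
  apply: filterS ihfin => x Ax; have := (gP x).2 Ax k.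
  rewrite -{2}(fineK Ax) -EFinM lee_fin.
  move=> gvk.
  have : `|g x - v k x| ^+ 2 <= (2 * Num.sqrt (fine (h x)) / 2 ^+ k) ^+ 2.
    by rewrite ler_pXn2r// nnegrE divr_ge0 ?mulr_ge0 ?sqrtr_ge0.
  rewrite real_normK ?num_real//; move/le_trans; apply.
  rewrite exprMn exprMn sqr_sqrtr ?fine_ge0// exprVn -exprM mulnC exprM.
  have -> : 2 ^+ 2 = 4 :> R by rewrite expr2; lra.
  by rewrite mulrAC.
(* The pointwise limit [g] is not known to be square integrable, but its difference with [v 0] is,
   by the bound [gv]. The limit in L^2 is then [v 0] plus the class of this difference. *)
have gL : (fun x => g x - v 0%N x) \in Lfun mu 2%:E.
  have mgv : measurable_fun setT (fun x => g x - v 0%N x).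
    by apply: measurable_funB => //; exact: L2_measurable.
  apply: Lfun2_sqr => //.
  apply: (@le_lt_trans _ _ (\int[mu]_x ((4 / 4 ^+ 0)%:E * h x))%E).
    apply: ae_ge0_le_integral => //.
    - by move=> x _; rewrite lee_fin sqr_ge0.
    - by apply/measurable_EFinP; apply: measurable_funX.
    - by move=> x _; rewrite mule_ge0// lee_fin c0.
    - exact: measurable_funeM.
    - by apply: filterS (gv 0%N) => x.
  rewrite ge0_integralZl// ?lee_fin ?c0//.
  apply: le_lt_trans (lee_wpmul2l _ ih) _; first by rewrite lee_fin c0.
  by rewrite mule1 ltry.
have [w wE] := L2_of_Lfun gL.
exists (v 0%N + w) => k.
rewrite -lee_fin -L2_dotN2 opprB.
apply: (@le_trans _ _ (\int[mu]_x ((4 / 4 ^+ k)%:E * h x))%E).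
  apply: (@L2_sqr_le _ (fun x => g x - v k x)) => //.
  - by apply: measurable_funB => //; exact: L2_measurable.
  - exact: measurable_funeM.
  - have e1 := L2_subE (v 0%N + w) (v k); have e2 := L2_addE (v 0%N) w.
    apply: filterS3 wE e1 e2 => x h1 -> ->; rewrite h1; ring.
  - by move=> x; rewrite mule_ge0// lee_fin c0.
rewrite ge0_integralZl// ?lee_fin ?c0//.
by rewrite -[leRHS]mule1 lee_wpmul2l// lee_fin c0.
Qed.

End L2_theory.

Section completeness.

Lemma L2_complete d (T : measurableType d) (R : realType)
    (mu : {measure set T -> \bar R}) (u : nat -> L2 mu) :
  (forall e : R, 0 < e -> exists N, forall m n, (N <= m)%N -> (N <= n)%N ->
     L2_dot (u m - u n) (u m - u n) <= e) ->
  exists l, forall e : R, 0 < e -> exists N, forall n, (N <= n)%N ->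
     L2_dot (l - u n) (l - u n) <= e.
Proof.
move=> uC.
have Nex k : exists N, forall m n, (N <= m)%N -> (N <= n)%N ->
    L2_dot (u m - u n) (u m - u n) <= 2^-1 / 8 ^+ k.
  by apply: uC; rewrite divr_gt0// exprn_gt0.
have {Nex} [N NP] := choice Nex.
(* Partial sums give nondecreasing indices, so that both [nk k] and [nk k.+1] exceed the threshold
   [N k]. *)
pose nk k := (\sum_(i < k.+1) N i)%N.
have nkN k : (N k <= nk k)%N by rewrite /nk big_ord_recr/= leq_addl.
have nkS k : (N k <= nk k.+1)%N.
  by apply: leq_trans (nkN k) _; rewrite /nk [leqRHS]big_ord_recr/= leq_addr.
have [l lP] := L2_fast_cvg (fun k => NP k _ _ (nkS k) (nkN k)).
exists l => e e0; have [k kP] := @geometric_small _ 4 (e / 4)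
  (divr_gt0 e0 (ltr0n _ 4)) (ler0n _ 4).
have {}kP := kP _ (leqnn k).
exists (nk k) => n nkn.
rewrite -L2_dotN2 opprB.
have -> : u n - l = (u n - u (nk k)) + (u (nk k) - l) by rewrite addrA subrK.
apply: le_trans (L2_dotD2_le _ _) _.
have h1 := NP k n (nk k) (leq_trans (nkN k) nkn) (nkN k).
have h2 := lP k.
have p2 : 0 < 2 ^+ k :> R by rewrite exprn_gt0.
have h3 : 4 / 4 ^+ k <= e / 4.
  apply: le_trans kP; rewrite ler_wpM2l// lef_pV2 ?posrE ?exprn_gt0//.
  by rewrite lerXn2r ?nnegrE// ler_nat.
have h4 : 2^-1 / 8 ^+ k <= e / 4.
  apply: le_trans kP; apply: ler_pM => //.
  - lra.
  by rewrite lef_pV2 ?posrE ?exprn_gt0// lerXn2r ?nnegrE// ler_nat.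
move: (le_trans h1 h4) (le_trans h2 h3).
move: (L2_dot _ _) (L2_dot _ _) => x y; lra.
Qed.

Context {R : realType} (Omega : set (plane R)) (oO : open Omega).
Local Notation mu := (area_on oO).

Lemma sob_norm_sqr m (u : sobolev oO m) : `|u| ^+ 2 = sob_dot u u.
Proof. by rewrite -[`|u|]/(sob_norm u) /sob_norm sqr_sqrtr// sob_dot_ge0. Qed.

Lemma sob_ip m : inner_product (@sob_dot R Omega oO m).
Proof.
split; [exact: sob_dotC|exact: sob_dot_lin|move=> u].
by rewrite sob_norm_sqr.
Qed.

Lemma sob_coord_sub m (u v : sobolev oO m) a : (u - v) a = u a - v a.
Proof. by rewrite !ffunE. Qed.

Lemma sob_coord_le m (u : sobolev oO m) a : L2_dot (u a) (u a) <= `|u| ^+ 2.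
Proof.
rewrite sob_norm_sqr /sob_dot (bigD1 a)//= lerDl sumr_ge0// => b _.
exact: L2_dot_ge0.
Qed.

Lemma sobolev_complete m : cauchy_complete (V := sobolev oO m).
Proof.
move=> u uC.
have lex a : exists l : L2 mu, forall e : R, 0 < e -> exists N, forall n, (N <= n)%N ->
     L2_dot (l - u n a) (l - u n a) <= e.
  apply: (@L2_complete _ _ _ _ (fun n => u n a)) => e e0.
  have se : 0 < Num.sqrt e by rewrite sqrtr_gt0.
  have [N NP] := uC _ se; exists N => p q Np Nq.
  rewrite -sob_coord_sub; apply: le_trans (sob_coord_le _ _) _.
  by rewrite -(sqr_sqrtr (ltW e0)) ler_pXn2r ?nnegrE ?sqrtr_ge0// NP.
have {lex} [l lP] := choice lex.
(* The limits taken coordinate by coordinate are still weak derivatives of one function: both sides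
   of the defining identity are inner products with fixed elements [F1] and [F2] of L^2, hence
   continuous. *)
have lW : [ffun a => l a] \in @weak_derivs R Omega oO m.
  apply/asboolP => a phi tphi; rewrite !ffunE.
  have L1 := test_fun_Lfun oO (midx a) tphi.
  have L2 := test_fun_Lfun oO (0, 0)%N tphi.
  have [F1 F1E] := L2_of_Lfun L1; have [F2 F2E] := L2_of_Lfun L2.
  have mL (f : plane R -> R) : f \in Lfun mu 2%:E -> measurable_fun setT f.
    by rewrite inE => /andP[]; rewrite inE.
  have E1 (w : Defs.L2 mu) : \int[mu]_x (w x * pderiv (midx a) phi x) = L2_dot w F1.
    by rewrite (@L2_dot_ae _ _ _ _ w F1 w _ (L2_measurable w) (mL _ L1) _ F1E)//;
      apply: aeW.
  have E2 (w : Defs.L2 mu) : \int[mu]_x (w x * phi x) = L2_dot w F2.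
    by rewrite (@L2_dot_ae _ _ _ _ w F2 w _ (L2_measurable w) (mL _ L2) _ F2E)//;
      apply: aeW.
  rewrite E1 E2.
  set s := (-1) ^+ morder a; set X := L2_dot _ F1; set Y := _ * _.
  (* The defect is squared so that the squared Cauchy-Schwarz inequality applies. With [K] as below,
     it is at most e (K - 1) / K < e; the 1 in [K] makes it positive. *)
  suff : (X - Y) ^+ 2 <= 0.
    by move=> XY; apply/eqP; rewrite -subr_eq0 -sqrf_eq0 eq_le XY sqr_ge0.
  apply/ler_addgt0Pr => e e0; rewrite add0r.
  pose K := L2_dot F1 F1 + L2_dot F2 F2 + 1.
  have F10 := L2_dot_ge0 F1; have F20 := L2_dot_ge0 F2.
  have K0 : 0 < K by rewrite /K ltr_wpDl// addr_ge0.
  have d0 : 0 < e / (2 * K) by rewrite divr_gt0// mulr_gt0.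
  have [N1 /(_ (maxn N1 _) (leq_maxl _ _)) N1P] := lP (multi0 m) _ d0.
  have [N2 N2P] := lP a _ d0.
  have {N1P} D1 := N1P N2; have {N2P} D2 := N2P _ (leq_maxr N1 N2).
  set n := maxn N1 N2 in D1 D2.
  have /asboolP/(_ a phi tphi) := valP (u n); rewrite E1 E2 -/s => W.
  have -> : X - Y = L2_dot (l (multi0 m) - u n (multi0 m)) F1 - s * L2_dot (l a - u n
    a) F2.
    by rewrite !L2_dotBl W /X /Y; ring.
  have s2 : s ^+ 2 = 1 by rewrite /s -exprM mulnC exprM sqrrN expr1n expr1n.
  have C1 := L2_CS_sqr (l (multi0 m) - u n (multi0 m)) F1.
  have C2 := L2_CS_sqr (l a - u n a) F2.
  have {}C1 := le_trans C1 (ler_wpM2r F10 D1).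
  have {}C2 := le_trans C2 (ler_wpM2r F20 D2).
  move: C1 C2; set p := L2_dot _ F1; set q := L2_dot _ F2 => C1 C2.
  have : (p - s * q) ^+ 2 <= 2 * p ^+ 2 + 2 * q ^+ 2.
    rewrite -subr_ge0; apply: le_trans (sqr_ge0 (p + s * q)) _.
    rewrite le_eqVlt; apply/orP; left; apply/eqP.
    have -> : 2 * q ^+ 2 = 2 * (s ^+ 2 * q ^+ 2) by rewrite s2 mul1r.
    ring.
  move/le_trans; apply; apply: (@le_trans _ _ (2 * (e / (2 * K)) * (K - 1))).
    rewrite /K; move: (e / (2 * K)) C1 C2 => z C1 C2; nra.
  have -> : 2 * (e / (2 * K)) * (K - 1) = e * ((K - 1) / K) by field; rewrite gt_eqF.
  by rewrite ler_piMr ?(ltW e0)// ler_pdivrMr// mul1r gerDl lerN10.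
exists (Sobolev lW); apply/cvgrPdist_le => e e0.
pose c := (#|{: multi_index m}|%:R + 1 : R).
have c0 : 0 < c by rewrite /c ltr_wpDl.
have d0 : 0 < e ^+ 2 / c by rewrite divr_gt0// exprn_gt0.
have Nex a := lP a _ d0.
have {Nex} [N NP] := choice Nex.
exists (\max_a N a)%N => // n /= Nn.
rewrite -(@ler_pXn2r _ 2%N) ?nnegrE ?(ltW e0)// sob_norm_sqr /sob_dot.
apply: (@le_trans _ _ (\sum_(a : multi_index m) e ^+ 2 / c)).
  apply: ler_sum => a _; rewrite sob_coord_sub /= ffunE; apply: NP.
  by apply: leq_trans Nn; exact: (leq_bigmax a).
rewrite sumr_const -mulr_natr mulrAC -mulrA ler_piMr ?exprn_ge0 ?(ltW e0)//.
by rewrite ler_pdivrMr// mul1r /c lerDl.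
Qed.

End completeness.

(** * Sobolev embedding *)

Section smooth_functions.
Context {R : realType}.

Lemma is_derive_diff (V W : normedModType R) (f : V -> W) x v :
  differentiable f x -> is_derive x v f ('D_v f x).
Proof. by move=> df; exact/derivableP/diff_derivable. Qed.

Lemma Ck_lin (V W : normedModType R) n k (f g : V -> W) :
  Ck n f -> Ck n g -> Ck n (fun x => k *: f x + g x).
Proof.
elim: n f g => [|n IH] f g /=.
  move=> cf cg x; apply: cvgD; last exact: cg.
  by apply: cvgZr; exact: cf.
move=> [df Df] [dg Dg]; split=> [x|v].
  by apply: differentiableD; [apply: differentiableZ; exact: df|exact: dg].
have -> : (fun x => 'D_v (fun y => k *: f y + g y) x) =
    (fun x => k *: 'D_v f x + 'D_v g x).
  apply/funext => x.
  have h1 := is_derive_diff v (df x); have h2 := is_derive_diff v (dg x).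
  by case: (is_deriveD (is_deriveZ k h1) h2).
exact: IH.
Qed.

Lemma smooth_lin (V W : normedModType R) k (f g : V -> W) :
  smooth f -> smooth g -> smooth (fun x => k *: f x + g x).
Proof. by move=> sf sg n; exact: Ck_lin. Qed.

Lemma smooth_derive (V W : normedModType R) (f : V -> W) v :
  smooth f -> smooth (fun x => 'D_v f x).
Proof. by move=> sf n; exact: (sf n.+1).2. Qed.

Lemma smooth_differentiable (V W : normedModType R) (f : V -> W) x :
  smooth f -> differentiable f x.
Proof. by move=> sf; exact: (sf 1%N).1. Qed.

Lemma iter_derive_lin (V W : normedModType R) k (f g : V -> W) v n :
  smooth f -> smooth g ->
  [/\ smooth (iter n (fun h x => 'D_v h x) f), smooth (iter n (fun h x => 'D_v h x) g) &
   iter n (fun h x => 'D_v h x) (fun x => k *: f x + g x) =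
   (fun x => k *: iter n (fun h x => 'D_v h x) f x + iter n (fun h x => 'D_v h x) g x)].
Proof.
move=> sf sg; elim: n => [|n [IHf IHg IH]]; first by split.
rewrite !iterS; split; [exact: smooth_derive|exact: smooth_derive|].
rewrite IH; apply/funext => x.
have h1 := is_derive_diff v (smooth_differentiable x IHf).
have h2 := is_derive_diff v (smooth_differentiable x IHg).
by case: (is_deriveD (is_deriveZ k h1) h2).
Qed.

Lemma pderiv_lin a k (f g : plane R -> R) : smooth f -> smooth g ->
  pderiv a (fun x => k * f x + g x) = (fun x => k * pderiv a f x + pderiv a g x).
Proof.
move=> sf sg; rewrite /pderiv.
have [sf2 sg2 ->] := iter_derive_lin k ((0, 1) : plane R) a.2 sf sg.
by have [_ _ ->] := iter_derive_lin k ((1, 0) : plane R) a.1 sf2 sg2.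
Qed.

Lemma test_fun_lin Omega k (f g : plane R -> R) :
  test_fun Omega f -> test_fun Omega g -> test_fun Omega (fun x => k * f x + g x).
Proof.
move=> [sf [K cK [KO f0]]] [sg [L cL [LO g0]]]; split; first exact: smooth_lin.
exists (K `|` L); first exact: compactU.
split=> [x [/KO|/LO]//|x /not_orP[/f0 -> /g0 ->]].
by rewrite mulr0 addr0.
Qed.

Lemma derive_along_line (V W : normedModType R) (f : V -> W) (p v : V) (t : R) d :
  is_derive (t *: v + p) v f d ->
  is_derive t 1 (fun s => f (s *: v + p)) d.
Proof.
move=> [dvf dE].
have E : (fun h : R => h^-1 *: (((fun s => f (s *: v + p)) \o shift t)
  (h *: 1) - f (t *: v + p))) =
    (fun h => h^-1 *: ((f \o shift (t *: v + p)) (h *: v) - f (t *: v + p))).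
  by apply/funext => h; rewrite /= [_%:A]mulr1 scalerDl addrA.
apply: DeriveDef; first by rewrite /derivable E; exact: dvf.
by rewrite /derive E.
Qed.

Lemma derive_translate (V W : normedModType R) (f : V -> W) (c q v : V) d :
  is_derive (c + q) v f d -> is_derive q v (fun q => f (c + q)) d.
Proof.
move=> [dvf dE].
have E : (fun h : R => h^-1 *: (((fun q => f (c + q)) \o shift q)
  (h *: v) - f (c + q))) =
    (fun h => h^-1 *: ((f \o shift (c + q)) (h *: v) - f (c + q))).
  by apply/funext => h; rewrite /= addrCA.
apply: DeriveDef; first by rewrite /derivable E; exact: dvf.
by rewrite /derive E.
Qed.

Lemma mean_value_along (V : normedModType R) (f df : V -> R) (p v : V) (s : R) :
  (forall x, is_derive x v f (df x)) -> 0 < s ->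
  exists2 c, 0 < c < s & f (s *: v + p) - f p = s * df (c *: v + p).
Proof.
move=> dfP s0.
have dP (t : R) : is_derive t 1 (fun s => f (s *: v + p)) (df (t *: v + p)).
  exact: derive_along_line.
have [|c cs E] := @MVT R (fun s => f (s *: v + p)) (fun t =>
  df (t *: v + p)) 0 s s0 (fun t _ => dP t).
  by apply: derivable_within_continuous => t _; case: (dP t).
by exists c => //; move: E; rewrite scale0r add0r subr0 mulrC.
Qed.

(** The mean value theorem is applied along [v] to the increment of [f] in direction [w], then along
    [w] to the derivative obtained. *)
Lemma second_difference (V : normedModType R) (f : V -> R) (p v w : V) (s : R) :
  Ck 2 f -> 0 < s ->
  exists x y : R, [/\ 0 < x < s, 0 < y < s &
    f (s *: w + (s *: v + p)) - f (s *: v + p) - (f (s *: w + p) - f p) =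
    s * (s * 'D_w (fun q => 'D_v f q) (y *: w + (x *: v + p)))].
Proof.
move=> [df /(_ v) [dvf _]] s0.
pose g q := f (s *: w + q) - f q.
have dg q : is_derive q v g ('D_v f (s *: w + q) - 'D_v f q).
  apply: is_deriveB (is_derive_diff v (df q)).
  exact/derive_translate/is_derive_diff.
have [x xs E] := mean_value_along p dg s0.
have [y ys E2] := mean_value_along (x *: v + p) (fun q => is_derive_diff w (dvf q)) s0.
by exists x, y; split => //; rewrite -E2 -E.
Qed.

(** The second difference is symmetric in [v] and [w]. Hence the two mixed derivatives take equal
    values at two points of a parallelogram of size 1/(n+1) at [p], and their continuity gives
    equality at [p]. *)
Lemma derive_comm (V : normedModType R) (f : V -> R) (v w : V) (p : V) :
  Ck 2 f -> 'D_w (fun q => 'D_v f q) p = 'D_v (fun q => 'D_w f q) p.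
Proof.
move=> f2; set A := LHS; set B := RHS.
have c1 : continuous (fun q => 'D_w (fun q => 'D_v f q) q) by exact: (f2.2 v).2.
have c2 : continuous (fun q => 'D_v (fun q => 'D_w f q) q) by exact: (f2.2 w).2.
have step n : exists x : R * R * (R * R),
    [/\ 0 < x.1.1 < n.+1%:R^-1, 0 < x.1.2 < n.+1%:R^-1, 0 < x.2.1 < n.+1%:R^-1,
      0 < x.2.2 < n.+1%:R^-1 &
    'D_w (fun q => 'D_v f q) (x.1.2 *: w + (x.1.1 *: v + p)) =
    'D_v (fun q => 'D_w f q) (x.2.2 *: v + (x.2.1 *: w + p))].
  have s0 : 0 < n.+1%:R^-1 :> R by rewrite invr_gt0.
  have [x [y [x1 y1 E1]]] := second_difference p v w f2 s0.
  have [x' [y' [x2 y2 E2]]] := second_difference p w v f2 s0.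
  exists ((x, y), (x', y')); split => //=.
  have ss : n.+1%:R^-1 * n.+1%:R^-1 != 0 :> R by rewrite gt_eqF// mulr_gt0.
  apply: (mulfI ss); rewrite -!mulrA -E1 -E2 (addrCA (_ *: v)); ring.
have {step} [x xP] := choice step.
have cvg0 (y : nat -> R) : (forall n, 0 < y n < n.+1%:R^-1) -> y n @[n --> \oo] -->
  (0 : R).
  move=> yP; apply: (@squeeze_cvgr _ _ _ _ (fun=> 0) (fun n => n.+1%:R^-1)).
  - by apply: nearW => n; have /andP[y0 /ltW ->] := yP n; rewrite ltW.
  - exact: cvg_cst.
  - exact: cvg_harmonic.
have cvgp (y z : nat -> R) u u' : (forall n, 0 < y n < n.+1%:R^-1) ->
    (forall n, 0 < z n < n.+1%:R^-1) -> y n *: u + (z n *: u' + p) @[n --> \oo] --> p.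
  move=> /cvg0 y0 /cvg0 z0; rewrite -[X in _ --> X]add0r -[X in _ --> X + _](scale0r u).
  apply: cvgD; first by apply: cvgZl.
  rewrite -[X in _ --> X]add0r -[X in _ --> X + _](scale0r u').
  by apply: cvgD; [apply: cvgZl|exact: cvg_cst].
have lim1 : 'D_w (fun q => 'D_v f q) ((x n).1.2 *: w + ((x n).1.1 *: v + p)) @[n -->
  \oo] --> A.
  apply: (@cvg_comp _ _ _ _ (fun q => 'D_w (fun q => 'D_v f q) q) _ (nbhs p));
    last exact: c1.
  by apply: cvgp => n; case: (xP n).
have lim2 : 'D_v (fun q => 'D_w f q) ((x n).2.2 *: v + ((x n).2.1 *: w + p)) @[n -->
  \oo] --> B.
  apply: (@cvg_comp _ _ _ _ (fun q => 'D_v (fun q => 'D_w f q) q) _ (nbhs p));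
    last exact: c2.
  by apply: cvgp => n; case: (xP n).
have E : (fun n => 'D_w (fun q => 'D_v f q) ((x n).1.2 *: w + ((x n).1.1 *: v + p))) =
    (fun n => 'D_v (fun q => 'D_w f q) ((x n).2.2 *: v + ((x n).2.1 *: w + p))).
  by apply/funext => n; case: (xP n).
rewrite E in lim1.
exact: (cvg_unique (@norm_hausdorff R R) lim1 lim2).
Qed.

End smooth_functions.

(** * Pointwise bound by the integral of a mixed derivative *)

Section integral_bound.
Context {R : realType}.
Local Notation leb := (@lebesgue_measure R).

Lemma norm_le_integral_derive (f df : R -> R) (a x : R) :
  (forall t : R, is_derive t 1 f (df t)) -> continuous df -> a < x -> f a = 0 ->
  (`|f x|%:E <= \int[leb]_t `|df t|%:E)%E.
Proof.
move=> fD cdf ax fa0.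
have cf : continuous f.
  by move=> t; apply/differentiable_continuous/derivable1_diffP; case: (fD t).
have := @continuous_FTC2 R df f a x ax (continuous_subspaceT cdf).
rewrite fa0 sube0 => E.
have -> : (`|f x|%:E = `| (f x)%:E |)%E by [].
have mdf : measurable_fun setT df by exact: continuous_measurable_fun.
rewrite -E; last 2 first.
- split=> [t _||]; first by case: (fD t).
    exact/cvg_at_right_filter/cf.
  exact/cvg_at_left_filter/cf.
- by move=> t _; rewrite derive1E; case: (fD t).
apply: le_trans (le_abse_integral _ _ _) _ => //.
  by apply/measurable_EFinP; exact: measurable_funTS.
apply: ge0_subset_integral => //.
by apply/measurable_EFinP; exact: measurableT_comp.
Qed.

(** Integration along the vertical line through the point bounds [psi] by the integral of |psi2|;
    integration along each horizontal line bounds |psi2| by that of |psi12|; Tonelli's theorem joins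
    the two. *)
Lemma norm_le_integral_mixed (K : set (plane R)) (psi psi2 psi12 : plane R -> R) :
  compact K -> (forall p, ~ K p -> psi p = 0) -> (forall p, ~ K p -> psi2 p = 0) ->
  (forall p, is_derive p ((0, 1) : plane R) psi (psi2 p)) ->
  (forall p, is_derive p ((1, 0) : plane R) psi2 (psi12 p)) ->
  continuous psi2 -> continuous psi12 ->
  forall p, (`|psi p|%:E <= \int[(leb \x leb)%E]_z `|psi12 z|%:E)%E.
Proof.
move=> cK psi0 psi20 D2 D12 c2 c12 [x y].
have [N [_ KN]] := compact_bounded cK.
pose M := `|N| + 1.
have KM p : M < `|p| -> ~ K p.
  have NM : N < M by rewrite /M ltr_pwDr// ler_norm.
  by move=> Mp Kp; have := lt_le_trans Mp (KN M NM p Kp); rewrite ltxx.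
(* A starting point to the left of [t] with modulus above [M]: any point of the plane having it as a
   coordinate lies outside [K], so the function integrated vanishes there. *)
have far (t : R) : exists2 a, a < t & M < `|a|.
  exists (- (`|t| + M + 1)); last by rewrite normrN ger0_norm; rewrite /M;
    have := normr_ge0 t; have := normr_ge0 N; lra.
  by have := ler_norm (- t); rewrite normrN /M; have := normr_ge0 N; lra.
have lineE (s t : R) : t *: ((0, 1) : plane R) + (s, 0) = (s, t).
  by congr pair; rewrite /= /GRing.scale/= ?mulr0 ?mulr1 ?add0r ?addr0.
have lineE1 (s t : R) : s *: ((1, 0) : plane R) + (0, t) = (s, t).
  by congr pair; rewrite /= /GRing.scale/= ?mulr0 ?mulr1 ?add0r ?addr0.
have D2' (s t : R) : is_derive t 1 (fun t => psi (s, t)) (psi2 (s, t)).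
  have := @derive_along_line _ _ _ psi (s, 0) (0, 1) t (psi2 (s, t)).
  rewrite lineE => /(_ (D2 _)).
  by under eq_fun do rewrite lineE.
have D12' (s t : R) : is_derive s 1 (fun s => psi2 (s, t)) (psi12 (s, t)).
  have := @derive_along_line _ _ _ psi2 (0, t) (1, 0) s (psi12 (s, t)).
  rewrite lineE1 => /(_ (D12 _)).
  by under eq_fun do rewrite lineE1.
have cline (h : plane R -> R) (v p : plane R) : continuous h -> continuous (fun t : R
  => h (t *: v + p)).
  move=> ch t; apply: (@cvg_comp _ _ _ (fun t =>
    t *: v + p) h _ (nbhs (t *: v + p))); last exact: ch.
  by apply: cvgD; [apply: cvgZl; exact: cvg_id|exact: cvg_cst].
have c2' (s : R) : continuous (fun t : R => psi2 (s, t)).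
  by have := cline psi2 (0, 1) (s, 0) c2; under eq_fun do rewrite lineE.
have c12' (t : R) : continuous (fun s : R => psi12 (s, t)).
  by have := cline psi12 (1, 0) (0, t) c12; under eq_fun do rewrite lineE1.
have m12 : measurable_fun setT (fun z => `|psi12 z|%:E).
  by apply/measurable_EFinP; apply: measurableT_comp => //;
    exact: continuous_plane_measurable.
have b1 : (`|psi (x, y)|%:E <= \int[leb]_t `|psi2 (x, t)|%:E)%E.
  have [a ay Ma] := far y.
  apply: (norm_le_integral_derive (D2' x) (c2' x) ay).
  by apply/psi0/KM; apply: lt_le_trans Ma _; rewrite {2}/Num.norm/= le_max lexx orbT.
apply: le_trans b1 _; rewrite fubini_tonelli2//.
apply: ge0_le_integral => //.
- by apply/measurable_EFinP; apply: measurableT_comp => //;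
  exact: continuous_measurable_fun.
- exact: measurable_fun_fubini_tonelli_G.
move=> t _; have [a ax Ma] := far x.
apply: (norm_le_integral_derive (D12' ^~ t) (c12' t) ax).
by apply/psi20/KM; apply: lt_le_trans Ma _; rewrite {2}/Num.norm/= le_max lexx.
Qed.

End integral_bound.

Section sobolev_bound.
Context {R : realType} (Omega : set (plane R)) (oO : open Omega).
Hypothesis bO : bounded_set Omega.
Local Notation mu := (area_on oO).

Lemma area_on_finite : (mu setT < +oo)%E.
Proof.
have [N [_ KN]] := bO.
pose M := `|N| + 1.
have OM : Omega `<=` `[- M, M] `*` `[- M, M].
  move=> x Kx; have : `|x| <= M by apply: KN => //; rewrite ltr_pwDr// ler_norm.
  rewrite /Num.norm/= ge_max => /andP[x1 x2].
  by split; rewrite /= in_itv /= -ler_norml.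
have mI : measurable (`[- M, M] : set (measurableTypeR R)) by exact: measurable_itv.
rewrite /area_on /= /mrestr setTI.
apply: (@le_lt_trans _ _
  ((lebesgue_measure \x lebesgue_measure)%E (`[- M, M] `*` `[- M, M]))).
  by apply: le_measure => //; rewrite inE//; [exact: open_plane_measurable|exact:
    measurableX].
rewrite product_measure1E//= lebesgue_measure_itv /=.
by case: ifP => _; rewrite -?EFinD -?EFinM ?mule0 ltry.
Qed.

Lemma smooth_norm_le_integral (K : set (plane R)) (psi : plane R -> R) (p : plane R) :
  compact K -> K `<=` Omega -> smooth psi -> (forall x, ~ K x -> psi x = 0) ->
  (`|psi p|%:E <= \int[mu]_z `|pderiv (1, 1)%N psi z|%:E)%E.
Proof.
move=> cK KO spsi psi0.
have s2 := smooth_derive ((0, 1) : plane R) spsi.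
have s12 := smooth_derive ((1, 0) : plane R) s2.
have clK : closed K by apply: compact_closed => //; exact: norm_hausdorff.
have psi20 := @pderiv_support R K (0, 1)%N psi clK psi0.
have psi120 := @pderiv_support R K (1, 1)%N psi clK psi0.
have h : (`|psi p|%:E <= \int[(lebesgue_measure \x lebesgue_measure)%E]_z
    `|pderiv (1, 1)%N psi z|%:E)%E.
  exact: (@norm_le_integral_mixed R K psi _ _ cK psi0 psi20
  (fun q => is_derive_diff _ (smooth_differentiable q spsi))
  (fun q => is_derive_diff _ (smooth_differentiable q s2)) (s2 0%N) (s12 0%N) p).
apply: le_trans h _.
have mO := open_plane_measurable oO.
have mchi : measurable_fun setT (fun z => `|pderiv (1, 1)%N psi z|%:E).
  apply/measurable_EFinP; apply: measurableT_comp => //.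
  by apply: continuous_plane_measurable; exact: s12 0%N.
rewrite (_ : (\int[_]_z _ = \int[lebesgue_measure \x lebesgue_measure]_(z in Omega)
  `|pderiv (1, 1)%N psi z|%:E)%E); last first.
  rewrite [RHS]integral_mkcond; apply: eq_integral => z _; rewrite patchE.
  case: ifPn => //; rewrite notin_setE => Oz.
  by rewrite psi120 ?normr0// => /KO.
rewrite (@eq_measure_integral _ _ _ Omega mu); last first.
  by move=> A mA AO; rewrite /area_on/= /mrestr setIidl.
by apply: ge0_subset_integral.
Qed.

(** Cauchy-Schwarz against the constant 1, whose squared norm is the area of [Omega], finite because
    [Omega] is bounded. *)
Lemma smooth_norm_le_L2 (K : set (plane R)) (psi : plane R -> R) (p : plane R)
    (X : L2 mu) :
  compact K -> K `<=` Omega -> smooth psi -> (forall x, ~ K x -> psi x = 0) ->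
  {ae mu, forall x, X x = pderiv (1, 1)%N psi x} ->
  `|psi p| ^+ 2 <= fine (mu setT) * L2_dot X X.
Proof.
move=> cK KO spsi psi0 XE.
have psip := smooth_norm_le_integral p cK KO spsi psi0.
have mX := L2_measurable X.
have aL : (fun x => `|X x|) \in Lfun mu 2%:E.
  apply: Lfun2_sqr; first exact: measurableT_comp.
  under eq_integral do rewrite real_normK ?num_real//.
  by rewrite -L2_sqrE ltry.
have oneL : (fun=> 1) \in Lfun mu 2%:E.
  apply: Lfun2_sqr => //; under eq_integral do rewrite expr1n.
  by rewrite integral_cst// mul1e area_on_finite.
have [Y YE] := L2_of_Lfun aL; have [I IE] := L2_of_Lfun oneL.
have maX : measurable_fun setT (fun x => `|X x|) by exact: measurableT_comp.
have YY : L2_dot Y Y = L2_dot X X.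
  rewrite (L2_dot_ae maX maX YE YE); congr fine; apply: eq_integral => x _.
  by rewrite -!expr2 real_normK ?num_real.
have II : L2_dot I I = fine (mu setT).
  rewrite (L2_dot_ae (@measurable_cst _ _ _ _ _ _) (@measurable_cst _ _ _ _ _ _) IE IE).
  congr fine; rewrite -[RHS]mul1e -integral_cst//.
  by apply: eq_integral => x _; rewrite mulr1.
have YI : (L2_dot Y I)%:E = (\int[mu]_z `|pderiv (1, 1)%N psi z|%:E)%E.
  rewrite (L2_dot_ae maX (@measurable_cst _ _ _ _ _ _) YE IE).
  rewrite /Rintegral fineK; last exact: (integrable_fin_num _ (Lfun2_integrable_mul
    aL oneL)).
  apply: ae_eq_integral => //.
  - by apply/measurable_EFinP; exact: measurable_funM.
  - apply/measurable_EFinP; apply: measurableT_comp => //.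
    exact: continuous_plane_measurable (smooth_pderiv (1, 1)%N spsi 0%N).
  - by apply: filterS XE => x -> _; rewrite mulr1.
rewrite -YI lee_fin in psip.
rewrite mulrC -YY -II; apply: le_trans (L2_CS_sqr Y I).
by rewrite ler_pXn2r// ?nnegrE// (le_trans _ psip).
Qed.

(** The mixed derivative d1 d2 of a first derivative of [phi] is a third derivative, hence one of
    the coordinates of [u] in H^3. *)
Lemma test_fun_grad_bound (u : sobolev oO 3) (phi : plane R -> R) b (p : plane R) :
  test_fun Omega phi ->
  (forall a, {ae mu, forall x, u a x = pderiv (midx a) phi x}) ->
  b = (0, 1)%N \/ b = (1, 0)%N ->
  `|pderiv b phi p| <= Num.sqrt (fine (mu setT)) * `|u|.
Proof.
move=> [sphi [K cK [KO phi0]]] uE bE.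
have clK : closed K by apply: compact_closed => //; exact: norm_hausdorff.
have A0 : 0 <= fine (mu setT) by apply: fine_ge0.
have [c cE] : exists c : multi_index 3, pderiv (midx c) phi = pderiv (1,
  1)%N (pderiv b phi).
  case: bE => ->; first by exists (@multi 3 1 2 isT).
  exists (@multi 3 2 1 isT).
  (* [pderiv] differentiates in the second variable before the first, so d1 d2 d1 has to be
     reordered as d1 d1 d2 to carry a multi-index. *)
  have E : (fun q => 'D_((0, 1) : plane R) (fun q => 'D_((1, 0) : plane R) phi q) q) =
      (fun q => 'D_((1, 0) : plane R) (fun q => 'D_((0, 1) : plane R) phi q) q).
    by apply/funext => q; exact: derive_comm (sphi 2%N).
  rewrite -[RHS]/(fun x => 'D_((1, 0) : plane R)
    (fun q => 'D_((0, 1) : plane R) (fun q => 'D_((1, 0) : plane R) phi q) q) x).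
  by rewrite E.
have uc := uE c; rewrite cE in uc.
have h := smooth_norm_le_L2 p cK KO (smooth_pderiv b sphi)
  (pderiv_support b clK phi0) uc.
rewrite -(@ler_pXn2r _ 2%N) ?nnegrE ?mulr_ge0 ?sqrtr_ge0//.
rewrite exprMn sqr_sqrtr//; apply: le_trans h _.
by rewrite ler_wpM2l// sob_coord_le.
Qed.

End sobolev_bound.

(** * The spaces H^m_0 *)

Section sobolev0_space.
Context {R : realType} (Omega : set (plane R)) (oO : open Omega).
Local Notation mu := (area_on oO).
Local Notation sobolev := (sobolev oO).
Local Notation sobolev0 m := (@sobolev0 R Omega oO m).

Definition is_test m (u : sobolev m) := exists2 phi, test_fun Omega phi &
  forall a, {ae mu, forall x, u a x = pderiv (midx a) phi x}.

Lemma sobolev0P m (u : sobolev m) :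
  sobolev0 m u <-> forall e : R, 0 < e -> exists2 s, is_test s & `|u - s| <= e.
Proof.
split=> [ucl e e0|uP].
  have [|s [ss us]] := ucl [set s | `|u - s| <= e].
    exact: (cvgrPdist_le _ _).1 cvg_id _ e0.
  by exists s.
move=> B /nbhs_ballP[e /= e0 eB].
have [s ss us] := uP (e / 2) (divr_gt0 e0 (ltr0n _ 2)).
exists s; split => //; apply: eB; rewrite -ball_normE /=.
by apply: le_lt_trans us _; rewrite ltr_pdivrMr// ltr_pMr// ltr1n.
Qed.

Lemma sobolev0_closed m : closed (sobolev0 m).
Proof. exact: closed_closure. Qed.

Lemma is_test_lin m k (u v : sobolev m) :
  is_test u -> is_test v -> is_test (k *: u + v).
Proof.
move=> [f tf uf] [g tg vg]; exists (fun x => k * f x + g x).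
  exact: test_fun_lin.
move=> a; rewrite (pderiv_lin _ _ tf.1 tg.1) !ffunE.
by apply: filterS3 (L2_linE k (u a) (v a)) (uf a) (vg a) => x -> -> ->.
Qed.

Lemma is_test0 m : is_test (0 : sobolev m).
Proof.
have smooth0 : smooth ((fun=> 0) : plane R -> R).
  elim=> [|n IH] /=; first by move=> x; exact: cvg_cst.
  split=> [x|v]; first exact: differentiable_cst.
  by under eq_fun do rewrite derive_cst.
exists (fun=> 0).
  by split => //; exists set0; [exact: compact0|split].
move=> a; have -> : pderiv (midx a) (fun=> 0) = ((fun=> 0) : plane R -> R).
  by apply/funext => x; apply: (@pderiv_support _ set0) => //; exact: closed0.
by rewrite ffunE; exact: L2_0E.
Qed.

Lemma sobolev00 m : sobolev0 m 0.
Proof.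
by apply/sobolev0P => e e0; exists 0; [exact: is_test0|rewrite subrr normr0 ltW].
Qed.

Lemma sobolev0_lin m k (u v : sobolev m) :
  sobolev0 m u -> sobolev0 m v -> sobolev0 m (k *: u + v).
Proof.
move=> /sobolev0P uP /sobolev0P vP; apply/sobolev0P => e e0.
have k0 : 0 < `|k| + 1 by rewrite ltr_wpDl.
have e2 : 0 < e / 2 by rewrite divr_gt0.
have [s ss us] := uP (e / 2 / (`|k| + 1)) (divr_gt0 e2 k0).
have [t tt vt] := vP (e / 2) e2.
exists (k *: s + t); first exact: is_test_lin.
have -> : k *: u + v - (k *: s + t) = k *: (u - s) + (v - t).
  by rewrite scalerBr opprD addrACA.
apply: le_trans (ler_normD _ _) _; rewrite normrZ [leRHS]splitr lerD//.
apply: le_trans (ler_wpM2l (normr_ge0 k) us) _.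
rewrite mulrCA ler_piMr ?(ltW e2)// ler_pdivrMr// mul1r lerDl//.
Qed.

Lemma sobolev0B m (u v : sobolev m) :
  sobolev0 m u -> sobolev0 m v -> sobolev0 m (u - v).
Proof. by move=> us vs; rewrite addrC -scaleN1r; exact: sobolev0_lin. Qed.

Lemma sobolev0N m (u : sobolev m) : sobolev0 m u -> sobolev0 m (- u).
Proof. by move=> us; rewrite -sub0r; apply: sobolev0B => //; exact: sobolev00. Qed.

Lemma multi_widen_inj m n (mn : (m <= n)%N) : injective (multi_widen mn).
Proof.
move=> a b /(congr1 (@midx n)); rewrite /multi_widen /midx /= => -[E1 E2].
apply: val_inj; rewrite /= [val a]surjective_pairing [val b]surjective_pairing.
by congr pair; exact: val_inj.
Qed.

Lemma sob_incl_lin m n (mn : (m <= n)%N) k (u v : sobolev n) :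
  sob_incl mn (k *: u + v) = k *: sob_incl mn u + sob_incl mn v.
Proof. by apply: val_inj; apply/ffunP => a; rewrite /= !ffunE. Qed.

Lemma sob_inclB m n (mn : (m <= n)%N) (u v : sobolev n) :
  sob_incl mn (u - v) = sob_incl mn u - sob_incl mn v.
Proof. by rewrite addrC -scaleN1r sob_incl_lin scaleN1r addrC. Qed.

(** The coordinates of the image are a subfamily of those of [u], because [multi_widen] is
    injective; the squared norm on the left is a partial sum of that on the right. *)
Lemma sob_incl_norm m n (mn : (m <= n)%N) (u : sobolev n) :
  `|sob_incl mn u| <= `|u|.
Proof.
rewrite -(@ler_pXn2r _ 2%N) ?nnegrE// !sob_norm_sqr /sob_dot.
under eq_bigr do rewrite /= ffunE.
rewrite [leRHS](bigID (mem (multi_widen mn @: [set: multi_index m]%SET))) /=.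
rewrite big_imset/=; last by move=> a b _ _; exact: multi_widen_inj.
rewrite [X in _ <= X + _](eq_bigl xpredT); last by move=> a; rewrite finset.in_setT.
by rewrite lerDl sumr_ge0// => b _; exact: L2_dot_ge0.
Qed.

Lemma sob_incl_sobolev0 m n (mn : (m <= n)%N) (u : sobolev n) :
  sobolev0 n u -> sobolev0 m (sob_incl mn u).
Proof.
move=> /sobolev0P uP; apply/sobolev0P => e e0; have [s [phi tphi sphi] us] := uP e e0.
exists (sob_incl mn s).
  by exists phi => // a; rewrite /= ffunE; exact: sphi.
by rewrite -sob_inclB; apply: le_trans (sob_incl_norm _ _) us.
Qed.

Hypothesis bO : bounded_set Omega.

Lemma sobolev0_grad_bound : exists2 C : R, 0 <= C &
  forall (u : sobolev 3) (a : multi_index 3), sobolev0 3 u ->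
    midx a = (0, 1)%N \/ midx a = (1, 0)%N ->
    {ae mu, forall x, `|u a x| <= C * `|u|}.
Proof.
(* The factor 2 covers the approximants: a test function within |u| of [u] has norm at most 2
   |u|. *)
exists (Num.sqrt (fine (mu setT)) * 2) => [|u a us ab];
  first by rewrite mulr_ge0// sqrtr_ge0.
have [->|u0] := eqVneq u 0.
  rewrite normr0 mulr0 ffunE; apply: filterS (@L2_0E _ _ _ mu) => x ->.
  by rewrite normr0.
have un0 : 0 < `|u| by rewrite normr_gt0.
pose B := Num.sqrt (fine (mu setT)) * 2 * `|u|.
have B0 : 0 <= B by rewrite mulr_ge0// mulr_ge0// sqrtr_ge0.
(* The excess of |u_a| over the bound is shown to be zero in L^2. Where an approximating test
   function obeys the bound, the excess is at most the distance from u_a to its derivative, which is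
   arbitrarily small in L^2. *)
pose f x := Num.max (`|u a x| - B) 0.
have mua := L2_measurable (u a).
have mf : measurable_fun setT f.
  apply: measurable_maxr; last exact: measurable_cst.
  by apply: measurable_funB; [exact: measurableT_comp|exact: measurable_cst].
have f0 x : 0 <= f x by rewrite /f le_max lexx orbT.
have fL : f \in Lfun mu 2%:E.
  apply: Lfun2_sqr => //.
  apply: (@le_lt_trans _ _ (\int[mu]_x ((u a x) ^+ 2)%:E)%E);
    last by rewrite -L2_sqrE ltry.
  apply: ge0_le_integral => //.
  - by move=> x _; rewrite lee_fin sqr_ge0.
  - by apply/measurable_EFinP; exact: measurable_funX.
  - by apply/measurable_EFinP; exact: measurable_funX.
  move=> x _; rewrite lee_fin -(real_normK (num_real (u a x))) ler_pXn2r ?nnegrE//.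
  by rewrite /f ge_max normr_ge0 andbT lerBlDr lerDl.
have [W WE] := L2_of_Lfun fL.
have WW (e : R) : 0 < e -> L2_dot W W <= e ^+ 2.
  move=> e0; have [|s [phi tphi sphi] us'] := (sobolev0P u).1 us (Num.min e `|u|).
    by rewrite lt_min e0.
  have /andP[use usu] : (`|u - s| <= e) && (`|u - s| <= `|u|) by rewrite -le_min.
  have sB x : `|pderiv (midx a) phi x| <= B.
    apply: le_trans (test_fun_grad_bound bO x tphi sphi ab) _.
    rewrite /B -mulrA ler_wpM2l ?sqrtr_ge0//.
    have -> : s = u - (u - s) by rewrite opprB addrC subrK.
    by apply: le_trans (ler_normB _ _) _; rewrite mulr2n mulrDl mul1r lerD2l.
  rewrite -lee_fin; apply: (@le_trans _ _ (L2_dot ((u - s) a) ((u - s) a))%:E);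
    last first.
    rewrite lee_fin; apply: le_trans (sob_coord_le _ _) _.
    by rewrite ler_pXn2r ?nnegrE// ltW.
  rewrite L2_sqrE; apply: (L2_sqr_le mf) => //.
  - by apply/measurable_EFinP; apply: measurable_funX; exact: L2_measurable.
  - by move=> x; rewrite lee_fin sqr_ge0.
  rewrite sob_coord_sub; apply: filterS2 (L2_subE (u a) (s a)) (sphi a) => x -> ->.
  rewrite lee_fin -(real_normK (num_real (_ - _))) ler_pXn2r ?nnegrE//.
  rewrite /f ge_max normr_ge0 andbT.
  by apply: le_trans (lerB_dist _ _); rewrite lerB.
have W0 : W = 0.
  apply: L2_dot_eq0; apply/eqP; rewrite eq_le L2_dot_ge0 andbT.
  apply/ler_addgt0Pr => e e0; rewrite add0r -(sqr_sqrtr (ltW e0)).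
  by apply: WW; rewrite sqrtr_gt0.
rewrite W0 in WE; apply: filterS2 WE (@L2_0E _ _ _ mu) => x -> fx.
have : `|u a x| - B <= f x by rewrite /f le_max lexx.
by rewrite fx subr_le0.
Qed.

End sobolev0_space.

(** * The energy *)

Section energy.
Context {R : realType} (Omega : set (plane R)) (oO : open Omega).
Local Notation mu := (area_on oO).
Local Notation sobolev := (sobolev oO).
Local Notation sobolev0 m := (@sobolev0 R Omega oO m).
Local Notation L2 := (L2 mu).

(** Riesz on H^3_0, applied to w |-> <w, u>, produces the projection, so the set under [xget] is
    inhabited. *)
Lemma P0_spec (u : sobolev 3) :
  sobolev0 3 (P0 u) /\ forall w, sobolev0 3 w -> sob_dot w (P0 u) = sob_dot w u.
Proof.
have ip := sob_ip oO 3.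
have [|||||v vS vP] := @riesz _ _ _ ip (sobolev0 3) (fun w =>
  sob_dot w u) `|u| (@sobolev_complete _ _ oO 3).
- exact: sobolev0_closed.
- exact: sobolev00.
- by move=> *; exact: sobolev0_lin.
- by move=> a x y _ _; exact: sob_dot_lin.
- by move=> w _; rewrite mulrC; exact: ip_cauchy_schwarz.
have [PS PP] : [set v | sobolev0 3 v /\ forall w,
  sobolev0 3 w -> sob_dot w (u - v) = 0] (P0 u).
  apply: (xgetPex 0); exists v; split => // w wS.
  by rewrite (ipBr ip) vP// subrr.
by split => // w wS; apply/esym/eqP; rewrite -subr_eq0 -(ipBr ip) PP.
Qed.

Lemma P0_in (u : sobolev 3) : sobolev0 3 (P0 u).
Proof. exact: (P0_spec u).1. Qed.

Arguments P0_in : clear implicits.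

Lemma P0_dot (u w : sobolev 3) : sobolev0 3 w -> sob_dot w (P0 u) = sob_dot w u.
Proof. exact: (P0_spec u).2. Qed.

Lemma P0_lin (k : R) (u v : sobolev 3) : P0 (k *: u + v) = k *: P0 u + P0 v.
Proof.
have ip := sob_ip oO 3.
have S1 := P0_in (k *: u + v); have S2 : sobolev0 3 (k *: P0 u + P0 v).
  by apply: sobolev0_lin; exact: P0_in.
have SB := sobolev0B S1 S2.
have E w : sobolev0 3 w -> sob_dot w (P0 (k *: u + v)) = sob_dot w (k *: P0 u + P0 v).
  move=> wS; rewrite (@P0_dot _ _ wS) !(ipDr ip) !(ipZr ip).
  by congr (_ * _ + _); [exact: esym (@P0_dot u _ wS)|exact: esym (@P0_dot v _ wS)].
apply/eqP; rewrite -subr_eq0 -normr_eq0 -sqrf_eq0 sob_norm_sqr (ipBr ip).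
by rewrite (E _ SB) subrr.
Qed.

Lemma P0_norm (u : sobolev 3) : `|P0 u| <= `|u|.
Proof.
have [->|P00] := eqVneq (P0 u) 0; first by rewrite normr0.
have : `|P0 u| ^+ 2 <= `|P0 u| * `|u|.
  rewrite sob_norm_sqr (@P0_dot u _ (P0_in u)).
  exact: (ip_le (sob_ip oO 3)).
by rewrite expr2 ler_pM2l// normr_gt0.
Qed.

(** The bilinear map whose diagonal is [F_D]; it is the Jacobian determinant of the pair (v, lap
    w). *)
Definition jacobian (v w : sobolev 3) (x : plane R) : R :=
  (grad_perp v x).1 * (grad_lap w x).1 + (grad_perp v x).2 * (grad_lap w x).2.

Lemma jacobian_measurable v w : measurable_fun setT (jacobian v w).
Proof.
have mL (u : L2) : measurable_fun setT (u : plane R -> R) := L2_measurable u.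
rewrite /jacobian /grad_perp /grad_lap /=.
apply: measurable_funD; apply: measurable_funM => //; last exact: measurable_funD.
  exact: measurableT_comp.
exact: measurable_funD.
Qed.

(** The class of [jacobian] in L^2. The default 0 would be taken if the product were not square
    integrable, which the bound on first derivatives excludes for [v] in H^3_0. *)
Definition L2_jacobian (v w : sobolev 3) : L2 :=
  xget 0 [set g : L2 | {ae mu, forall x, g x = jacobian v w x}].

Hypothesis bO : bounded_set Omega.

Lemma L2_jacobian_spec : exists2 K : R, 0 <= K & forall v w, sobolev0 3 v ->
  {ae mu, forall x, (L2_jacobian v w) x = jacobian v w x} /\
  L2_dot (L2_jacobian v w) (L2_jacobian v w) <= (K * (`|v| * `|w|)) ^+ 2.
Proof.
have [C C0 CP] := sobolev0_grad_bound oO bO.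
(* With first derivatives of [v] at most c = C |v|, the squared Jacobian is at most 2 c^2 (p^2 +
   q^2), and p and q each have squared norm at most 4 |w|^2; in total 16 c^2 |w|^2. *)
exists (4 * C) => [|v w vS]; first by rewrite mulr_ge0.
pose c := C * `|v|.
have v1 : {ae mu, forall x, `|v (@multi 3 0 1 isT) x| <= c} by apply: CP => //; left.
have v2 : {ae mu, forall x, `|v (@multi 3 1 0 isT) x| <= c} by apply: CP => //; right.
have c0 : 0 <= c by rewrite mulr_ge0.
pose p : L2 := w (@multi 3 3 0 isT) + w (@multi 3 1 2 isT).
pose q : L2 := w (@multi 3 2 1 isT) + w (@multi 3 0 3 isT).
have mj := jacobian_measurable v w.
have mL (u : L2) : measurable_fun setT (u : plane R -> R) := L2_measurable u.
pose h (x : plane R) := (2 * c ^+ 2 * (p x ^+ 2 + q x ^+ 2))%:E.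
have h0 x : (0 <= h x)%E.
  by rewrite lee_fin !mulr_ge0 ?exprn_ge0// addr_ge0// sqr_ge0.
have mh : measurable_fun setT h.
  apply/measurable_EFinP; apply: measurable_funM => //.
  by apply: measurable_funD; exact: measurable_funX.
have jh : {ae mu, forall x, ((jacobian v w x ^+ 2)%:E <= h x)%E}.
  have pE : {ae mu, forall x, p x = w (@multi 3 3 0 isT) x + w (@multi 3 1 2 isT) x}.
    exact: L2_addE.
  have qE : {ae mu, forall x, q x = w (@multi 3 2 1 isT) x + w (@multi 3 0 3 isT) x}.
    exact: L2_addE.
  have v12 : {ae mu, forall x, `|v (@multi 3 0 1 isT) x| <= c /\ `|v (@multi 3 1 0
    isT) x| <= c}.
    by apply: filterS2 v1 v2 => x.
  apply: filterS3 v12 pE qE => x.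
  rewrite /h /jacobian /grad_perp /grad_lap /= => -[h1 h2] <- <-.
  rewrite lee_fin; move: h1 h2.
  move: (p x) (q x) (v _ x) (v _ x) => P Q a b ha hb.
  have a2 : a ^+ 2 <= c ^+ 2 by rewrite -(real_normK (num_real a)) ler_pXn2r ?nnegrE.
  have b2 : b ^+ 2 <= c ^+ 2 by rewrite -(real_normK (num_real b)) ler_pXn2r ?nnegrE.
  have := sqr_ge0 (a * P + b * Q).
  have := ler_wpM2r (sqr_ge0 P) a2; have := ler_wpM2r (sqr_ge0 Q) b2; nra.
have ih : (\int[mu]_x h x <= ((4 * C * (`|v| * `|w|)) ^+ 2)%:E)%E.
  rewrite /h; under eq_integral do rewrite EFinM EFinD.
  rewrite ge0_integralZl//; last 3 first.
  - apply: emeasurable_funD; apply/measurable_EFinP; exact: measurable_funX.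
  - by move=> x _; rewrite adde_ge0// lee_fin sqr_ge0.
  - by rewrite lee_fin mulr_ge0// exprn_ge0.
  rewrite ge0_integralD//; last 4 first.
  - by move=> x _; rewrite lee_fin sqr_ge0.
  - by apply/measurable_EFinP; exact: measurable_funX.
  - by move=> x _; rewrite lee_fin sqr_ge0.
  - by apply/measurable_EFinP; exact: measurable_funX.
  rewrite -!L2_sqrE -EFinD -EFinM lee_fin.
  have wle a b : L2_dot (w a + w b) (w a + w b) <= 4 * `|w| ^+ 2.
    apply: le_trans (L2_dotD2_le _ _) _.
    have := sob_coord_le w a; have := sob_coord_le w b.
    move: (L2_dot _ _) (L2_dot _ _) (`|w| ^+ 2) => x y z; lra.
  have := lerD (wle (@multi 3 3 0 isT) (@multi 3 1 2 isT)) (wle (@multi 3 2 1 isT)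
    (@multi 3 0 3 isT)).
  rewrite -/p -/q => hpq.
  have c2 : 0 <= 2 * c ^+ 2 by rewrite mulr_ge0// exprn_ge0.
  apply: le_trans (ler_wpM2l c2 hpq) _.
  by rewrite le_eqVlt; apply/orP; left; apply/eqP; rewrite /c; ring.
have jL : jacobian v w \in Lfun mu 2%:E.
  apply: Lfun2_sqr => //; apply: le_lt_trans (ltry _).
  apply: le_trans ih; apply: ae_ge0_le_integral => //.
  - by move=> x _; rewrite lee_fin sqr_ge0.
  - by apply/measurable_EFinP; exact: measurable_funX.
  - by apply: filterS jh => x.
have E : {ae mu, forall x, (L2_jacobian v w) x = jacobian v w x}.
  have [g gE] := L2_of_Lfun jL.
  by apply: (@xgetPex _ _ [set g : L2 | {ae mu, forall x, g x = jacobian v w x}]);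
    exists g.
split => //; rewrite -lee_fin; apply: le_trans ih.
exact: (L2_sqr_le mj mh E h0 jh).
Qed.

Lemma L2_jacobianE v w : sobolev0 3 v ->
  {ae mu, forall x, (L2_jacobian v w) x = jacobian v w x}.
Proof. by have [K _ KP] := L2_jacobian_spec => /KP-/(_ w)[]. Qed.

Lemma L2_jacobian_linl k u v w : sobolev0 3 u -> sobolev0 3 v ->
  L2_jacobian (k *: u + v) w = k *: L2_jacobian u w + L2_jacobian v w.
Proof.
move=> uS vS; apply: L2_ext.
have coordE a : {ae mu, forall x, (k *: u + v) a x = k * u a x + v a x}.
  by rewrite !ffunE; exact: L2_linE.
have j0 := L2_jacobianE w (@sobolev0_lin _ _ _ _ k _ _ uS vS).
have j1 := L2_jacobianE w uS; have j2 := L2_jacobianE w vS.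
have c1 := coordE (@multi 3 0 1 isT); have c2 := coordE (@multi 3 1 0 isT).
have l := L2_linE k (L2_jacobian u w) (L2_jacobian v w).
near=> x.
rewrite (near l x)// (near j0 x)// (near j1 x)// (near j2 x)//.
rewrite /jacobian /grad_perp /= (near c1 x)// (near c2 x)//; ring.
Unshelve. all: by end_near. Qed.

Lemma L2_jacobian_linr k u v w : sobolev0 3 u ->
  L2_jacobian u (k *: v + w) = k *: L2_jacobian u v + L2_jacobian u w.
Proof.
move=> uS; apply: L2_ext.
have coordE a : {ae mu, forall x, (k *: v + w) a x = k * v a x + w a x}.
  by rewrite !ffunE; exact: L2_linE.
have j0 := L2_jacobianE (k *: v + w) uS.
have j1 := L2_jacobianE v uS; have j2 := L2_jacobianE w uS.
have c1 := coordE (@multi 3 3 0 isT); have c2 := coordE (@multi 3 1 2 isT).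
have c3 := coordE (@multi 3 2 1 isT); have c4 := coordE (@multi 3 0 3 isT).
have l := L2_linE k (L2_jacobian u v) (L2_jacobian u w).
near=> x.
rewrite (near l x)// (near j0 x)// (near j1 x)// (near j2 x)//.
rewrite /jacobian /grad_lap /= (near c1 x)// (near c2 x)// (near c3 x)// (near c4 x)//.
ring.
Unshelve. all: by end_near. Qed.

(** [P0] stands in every slot: it is linear, so the form is still multilinear, and it puts the first
    argument of each Jacobian in H^3_0. *)
Definition energy_form (a b c d : sobolev 3) : R :=
  L2_dot (L2_jacobian (P0 a) (P0 b)) (L2_jacobian (P0 c) (P0 d)).

Lemma energy_form_bound : exists2 K : R, 0 <= K & forall a b c d,
  `|energy_form a b c d| <= K * (`|a| * `|b| * `|c| * `|d|).
Proof.
have [K K0 KP] := L2_jacobian_spec; exists (K * K) => [|a b c d];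
  first by rewrite mulr_ge0.
have bound u v : 0 <= L2_dot (L2_jacobian (P0 u) (P0 v)) (L2_jacobian (P0 u)
  (P0 v)) <= (K * (`|u| * `|v|)) ^+ 2.
  rewrite L2_dot_ge0; apply: le_trans (KP _ (P0 v) (P0_in u)).2 _.
  rewrite ler_pXn2r ?nnegrE ?mulr_ge0// ler_wpM2l//.
  by rewrite ler_pM// P0_norm.
rewrite -(@ler_pXn2r _ 2%N) ?nnegrE ?mulr_ge0// real_normK ?num_real//.
apply: le_trans (L2_CS_sqr _ _) _.
have /andP[x0 x1] := bound a b; have /andP[y0 y1] := bound c d.
apply: le_trans (ler_pM x0 y0 x1 y1) _.
by rewrite le_eqVlt; apply/orP; left; apply/eqP; ring.
Qed.

Lemma energyE u : energy u = quartic energy_form u.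
Proof.
rewrite /energy /quartic; congr (_ * _).
have BE := L2_jacobianE (P0 u) (P0_in u).
set B := L2_jacobian _ _ in BE.
have -> : ('N[mu]_2%:E[EFin \o F_D (P0 u)] = (Num.sqrt (L2_dot B B))%:E)%E.
  rewrite unlock /Lnorm.
  have -> : (\int[mu]_x `|(EFin \o F_D (P0 u)) x| `^ 2 = (L2_dot B B)%:E)%E.
    have E (x : plane R) : (`|(EFin \o F_D (P0 u)) x| `^ 2 = (jacobian (P0 u)
      (P0 u) x ^+ 2)%:E)%E.
      rewrite /comp. by rewrite abse_EFin poweR_EFin powR_mulrn// real_normK ?num_real.
    under eq_integral do rewrite E; rewrite L2_sqrE; apply: ae_eq_integral => //.
    - by apply/measurable_EFinP; apply: measurable_funX; exact: jacobian_measurable.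
    - by apply/measurable_EFinP; apply: measurable_funX; exact: L2_measurable.
    - by apply: filterS BE => x -> _.
  by rewrite poweR_EFin powR12_sqrt// L2_dot_ge0.
by rewrite /= sqr_sqrtr// L2_dot_ge0.
Qed.

End energy.

(** * The gradient flow *)

Section one_sided_derivative.
Context {R : realType} {V : normedModType R}.

(** At t > 0 the constraint 0 <= t + h holds for all small h, so restricting the filter changes
    nothing. *)
Lemma has_deriv_from0_is_derive (y : R -> V) (t : R) v : 0 < t ->
  has_deriv_from0 y t v <-> is_derive t 1 y v.
Proof.
move=> t0; rewrite is_derive_cvgP /has_deriv_from0.
under [in X in X <-> _]eq_fun do rewrite (addrC t).
split; last exact: cvg_within_filter.
move=> yv A /yv; rewrite /nbhs /= /within /= => yA.
have ht : \forall h \near (0 : R)^', 0 <= t + h.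
  have : \forall h \near (0 : R), - t < h by apply: lt_nbhsr; rewrite oppr_lt0.
  move/nbhs_dnbhs; apply: filterS => h th.
  by rewrite -lerBlDl sub0r ltW.
by apply: filterS2 yA ht => h hA /hA.
Qed.

(** Near t the difference quotients lie within 1 of dy t, so that |y s - y t| <= (|dy t| + 1) |s -
    t| for admissible s. *)
Lemma has_deriv_from0_continuous (y dy : R -> V) (T : R) :
  (forall t, 0 <= t -> has_deriv_from0 y t (dy t)) ->
  {within `[0, T], continuous y}.
Proof.
move=> yD; apply/subspace_continuousP => t; rewrite /= in_itv/= => /andP[t0 _].
apply/cvgrPdist_le => e e0.
have near1 : \forall h \near within [set h | 0 <= t + h] (0 : R)^',
    `|dy t - h^-1 *: (y (t + h) - y t)| <= 1.
  exact: (cvgrPdist_le _ _).1 (yD t t0) 1 ltr01.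
have M0 : 0 < `|dy t| + 1 by rewrite ltr_wpDl.
have step h : h != 0 -> `|dy t - h^-1 *: (y (t + h) - y t)| <= 1 ->
    `|y (t + h) - y t| <= (`|dy t| + 1) * `|h|.
  move=> h0 h1; have -> : y (t + h) - y t = h *: (h^-1 *: (y (t + h) - y t)).
    by rewrite scalerA divff// scale1r.
  rewrite normrZ mulrC ler_wpM2r//.
  set w := h^-1 *: _ in h1 *; have -> : w = dy t - (dy t - w)
    by rewrite opprB addrC subrK.
  by apply: le_trans (ler_normB _ _) _; rewrite lerD2l.
have : nbhs (0 : R) [set h | h != 0 -> 0 <= t + h ->
    `|dy t - h^-1 *: (y (t + h) - y t)| <= 1] by exact: near1.
move=> /nbhs_ballP[d /= d0 dP].
apply/nbhs_ballP; exists (Num.min d (e / (`|dy t| + 1))) => /=.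
  by rewrite lt_min d0 divr_gt0.
move=> s; rewrite /ball/= lt_min => /andP[sd se]; rewrite in_itv/= => /andP[s0 sT].
have [->|st] := eqVneq s t; first by rewrite subrr normr0 ltW.
have stE : s = t + (s - t) by rewrite addrC subrK.
have st0 : s - t != 0 by rewrite subr_eq0.
have := step _ st0 (dP (s - t) _ st0 _).
rewrite -stE => h; rewrite distrC; apply: le_trans (h _ s0) _.
  by rewrite /ball/= sub0r normrN distrC.
by rewrite mulrC -ler_pdivlMr// distrC ltW.
Qed.

Lemma is_derive_has_deriv_from0 (z : R -> V) (t : R) v :
  is_derive t 1 z v -> has_deriv_from0 z t v.
Proof.
move=> /is_derive_cvgP h; rewrite /has_deriv_from0.
under eq_fun do rewrite (addrC t).
exact: cvg_within_filter.
Qed.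
End one_sided_derivative.

(** * The vector field of the flow on H^k *)

Section flow.
Context {R : realType} (Omega : set (plane R)) (oO : open Omega).
Hypothesis bO : bounded_set Omega.
Local Notation sobolev := (sobolev oO).
Local Notation sobolev0 m := (@sobolev0 R Omega oO m).
Local Notation form := (@energy_form R Omega oO).

Lemma energy_form_lin1 k u v b c d : form (k *: u + v) b c d = k * form u b c d +
  form v b c d.
Proof.
apply: etrans (congr1 (fun p => L2_dot (L2_jacobian p (P0 b)) (L2_jacobian (P0 c)
  (P0 d))) (P0_lin k u v)) _.
apply: etrans (congr1 (fun q => L2_dot q (L2_jacobian (P0 c) (P0 d)))
  (L2_jacobian_linl bO k (P0 b) (@P0_in _ _ _ u) (@P0_in _ _ _ v))) _.
exact: L2_dot_lin.
Qed.

Lemma energy_form_lin2 k u v a c d : form a (k *: u + v) c d = k * form a u c d +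
  form a v c d.
Proof.
apply: etrans (congr1 (fun p => L2_dot (L2_jacobian (P0 a) p) (L2_jacobian (P0 c)
  (P0 d))) (P0_lin k u v)) _.
apply: etrans (congr1 (fun q => L2_dot q (L2_jacobian (P0 c) (P0 d)))
  (L2_jacobian_linr bO k (P0 u) (P0 v) (@P0_in _ _ _ a))) _.
exact: L2_dot_lin.
Qed.

Lemma energy_form_lin3 k u v a b d : form a b (k *: u + v) d = k * form a b u d +
  form a b v d.
Proof.
apply: etrans (congr1 (fun p => L2_dot (L2_jacobian (P0 a) (P0 b))
  (L2_jacobian p (P0 d))) (P0_lin k u v)) _.
apply: etrans (congr1 (fun q => L2_dot (L2_jacobian (P0 a) (P0 b)) q)
  (L2_jacobian_linl bO k (P0 d) (@P0_in _ _ _ u) (@P0_in _ _ _ v))) _.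
exact: L2_dot_lin2.
Qed.

Lemma energy_form_lin4 k u v a b c : form a b c (k *: u + v) = k * form a b c u +
  form a b c v.
Proof.
apply: etrans (congr1 (fun p => L2_dot (L2_jacobian (P0 a) (P0 b))
  (L2_jacobian (P0 c) p)) (P0_lin k u v)) _.
apply: etrans (congr1 (fun q => L2_dot (L2_jacobian (P0 a) (P0 b)) q)
  (L2_jacobian_linr bO k (P0 u) (P0 v) (@P0_in _ _ _ c))) _.
exact: L2_dot_lin2.
Qed.

(** Riesz on the whole of H^3 represents the bounded linear form [dquartic], which is the
    differential of the energy; this gives the existence of the Sobolev gradient. *)
Lemma sob_grad_energy (u h : sobolev 3) :
  sob_dot h (sob_grad (@energy R Omega oO) u) = dquartic form u h.
Proof.
have [K K0 KP] := energy_form_bound oO bO.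
have [_ dE] := diff_quartic energy_form_lin1 energy_form_lin2 energy_form_lin3
  energy_form_lin4 KP K0 u.
have EE : @energy R Omega oO = quartic form by apply/funext => v; exact: energyE.
have [|||||v _ vP] := @riesz _ _ _ (sob_ip oO 3) setT (dquartic form u)
  (2 * K * `|u| ^+ 3) (@sobolev_complete _ _ oO 3).
- exact: closedT.
- by [].
- by [].
- by move=> k a b _ _; exact: (dquartic_lin energy_form_lin1 energy_form_lin2
  energy_form_lin3 energy_form_lin4).
- by move=> a _; exact: (dquartic_bound KP).
have : [set v : sobolev 3 | forall h, 'd (@energy R Omega oO) u h = sob_dot h v]
  (sob_grad (@energy R Omega oO) u).
  by apply: (xgetPex 0); exists v => w; rewrite EE dE vP.
by move=> /(_ h) <-; rewrite EE dE.
Qed.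

Variables (k : nat) (hk : (3 <= k)%N).

(** The inclusion does not increase norms, so y |-> <y, x> in H^3 is a bounded form on H^k_0 and
    Riesz applies there. *)
Lemma M0_spec (x : sobolev 3) : sobolev0 k (M0 hk x) /\
  forall y, sobolev0 k y -> sob_dot y (M0 hk x) = sob_dot (sob_incl hk y) x.
Proof.
have [|||||v vS vP] := @riesz _ _ _ (sob_ip oO k) (sobolev0 k) (fun y =>
  sob_dot (sob_incl hk y) x) `|x| (@sobolev_complete _ _ oO k).
- exact: sobolev0_closed.
- exact: sobolev00.
- by move=> *; exact: sobolev0_lin.
- by move=> a u w _ _; rewrite sob_incl_lin sob_dot_lin.
- move=> u _; apply: le_trans (ip_cauchy_schwarz (sob_ip oO 3) _ _) _.
  by rewrite mulrC ler_wpM2l// sob_incl_norm.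
have [MS MP] : [set v : sobolev k | sobolev0 k v /\ forall y,
  sobolev0 k y -> sob_dot (sob_incl hk y) x = sob_dot y v] (M0 hk x).
  by apply: (xgetPex 0); exists v; split => // y yS; rewrite vP.
by split => // y yS; rewrite MP.
Qed.

Definition flow_field (z : sobolev k) : sobolev k :=
  - M0 hk (P0 (sob_grad (@energy R Omega oO) (sob_incl hk z))).

Lemma flow_field_in z : sobolev0 k (flow_field z).
Proof. by apply: sobolev0N; exact: (M0_spec _).1. Qed.

(** On H^k_0 the field is minus the gradient of the energy: [P0] disappears because the inclusion of
    [y] lies in H^3_0. *)
Lemma flow_field_dot z y : sobolev0 k y ->
  sob_dot y (flow_field z) = - dquartic form (sob_incl hk z) (sob_incl hk y).
Proof.
move=> yS; rewrite /flow_field (ipNr (sob_ip oO k)) ((M0_spec _).2 y yS).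
by rewrite (@P0_dot _ _ _ _ _ (@sob_incl_sobolev0 _ _ _ _ _ hk _ yS)) sob_grad_energy.
Qed.

(** The difference of two values of the field lies in H^k_0 and may be paired with itself, which
    reduces the claim to the Lipschitz bound on [dquartic] in H^3. *)
Lemma flow_field_lip (r : R) : exists L : R, forall a b, `|a| <= r -> `|b| <= r ->
  `|flow_field a - flow_field b| <= L * `|a - b|.
Proof.
have [K K0 KP] := energy_form_bound oO bO.
have c0 : 0 <= 6 * K * r ^+ 2 by rewrite mulr_ge0 ?sqr_ge0// mulr_ge0.
exists (6 * K * r ^+ 2) => a b ar br; set y := flow_field a - flow_field b.
have yS : sobolev0 k y by apply: sobolev0B; exact: flow_field_in.
have [->|y0] := eqVneq y 0; first by rewrite normr0 mulr_ge0.
have E : sob_dot y y = dquartic form (sob_incl hk b) (sob_incl hk y) -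
    dquartic form (sob_incl hk a) (sob_incl hk y).
  apply: etrans (ipBr (sob_ip oO k) (flow_field a) (flow_field b) y) _.
  apply: etrans (congr2 (fun p q => p - q) (flow_field_dot a yS)
    (flow_field_dot b yS)) _.
  have oppB (p q : R) : - p - - q = q - p by rewrite opprK addrC.
  exact: oppB.
have : `|y| ^+ 2 <= 6 * K * r ^+ 2 * `|a - b| * `|y|.
  rewrite sob_norm_sqr E; apply: le_trans (ler_norm _) _; rewrite distrC.
  apply: le_trans (@dquartic_lip _ _ _ _ energy_form_lin1 energy_form_lin2
    energy_form_lin3 energy_form_lin4 KP K0 _ _ _ r
    (le_trans (sob_incl_norm hk a) ar) (le_trans (sob_incl_norm hk b) br)) _.
  rewrite -sob_inclB; apply: ler_pM (sob_incl_norm hk y) => //; first exact: mulr_ge0.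
  exact: ler_wpM2l c0 _ _ (sob_incl_norm hk (a - b)).
by rewrite expr2 ler_pM2r// normr_gt0.
Qed.

Definition energy_incl (z : sobolev k) : R := energy (sob_incl hk z).

(** Pulled back along the inclusion, the form is again quartic and bounded, with the same constant.
    Its differential at [z] in the direction G z is given by [flow_field_dot] with y = G z. *)
Lemma energy_incl_diff z : differentiable energy_incl z /\
  'd energy_incl z (flow_field z) = - `|flow_field z| ^+ 2.
Proof.
have [K K0 KP] := energy_form_bound oO bO.
pose Q a b c d := form (sob_incl hk a) (sob_incl hk b) (sob_incl hk c) (sob_incl hk d).
have EE : energy_incl = quartic Q.
  by apply/funext => v; rewrite /energy_incl energyE.
have [|||||dE EQ] := @diff_quartic _ _ Q K _ _ _ _ _ K0 z.
- move=> m u v a b c; apply: etrans (congr1 (fun p =>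
  form p _ _ _) (sob_incl_lin hk m u v)) _.
  exact: energy_form_lin1.
- move=> m u v a b c; apply: etrans (congr1 (fun p =>
  form _ p _ _) (sob_incl_lin hk m u v)) _.
  exact: energy_form_lin2.
- move=> m u v a b c; apply: etrans (congr1 (fun p =>
  form _ _ p _) (sob_incl_lin hk m u v)) _.
  exact: energy_form_lin3.
- move=> m u v a b c; apply: etrans (congr1 (fun p =>
  form _ _ _ p) (sob_incl_lin hk m u v)) _.
  exact: energy_form_lin4.
- move=> a b c d; apply: le_trans (KP _ _ _ _) _; rewrite ler_wpM2l//.
  by rewrite !ler_pM ?mulr_ge0// sob_incl_norm.
rewrite EE; split => //; rewrite EQ.
rewrite sob_norm_sqr.
exact: etrans (esym (opprK _)) (congr1 -%R (esym (flow_field_dot z (@flow_field_in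
  z)))).
Qed.

Lemma energy_incl_ge0 z : 0 <= energy_incl z.
Proof. by rewrite /energy_incl /energy mulr_ge0// ?invr_ge0// sqr_ge0. Qed.
End flow.

Theorem theorem5 (R : realType) (Omega : set (plane R)) (oO : open Omega)
    (bO : bounded_set Omega) (sO : smooth_boundary Omega)
    (k : nat) (k3 : (3 < k)%N)
    (g : plane R -> R) (gC1 : C1_on (boundary Omega) g)
    (w0 : sobolev oO k) (w0g : has_boundary_value w0 g) :
  exists z : R -> sobolev oO k, gradient_flow (ltnW k3) w0 z /\
    forall y : R -> sobolev oO k, gradient_flow (ltnW k3) w0 y ->
      forall t, 0 <= t -> y t = z t.
Proof.
have ip := sob_ip oO k.
pose G := @flow_field R Omega oO k (ltnW k3).
have G_lip := @flow_field_lip R Omega oO bO k (ltnW k3).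
have Gc := @G_continuous R (sobolev oO k) G G_lip.
have e_ge0 := @energy_incl_ge0 R Omega oO k (ltnW k3).
have e_diff a := (@energy_incl_diff R Omega oO bO k (ltnW k3) a).1.
have e_dec a := (@energy_incl_diff R Omega oO bO k (ltnW k3) a).2.
have [z [z0 zD]] := @gradient_flow_exists _ _ _ ip _ _ G_lip
  e_ge0 e_diff e_dec w0 (@sobolev_complete _ _ oO k).
have zflow : gradient_flow (ltnW k3) w0 z.
  split => //; exists (fun t => G (z t)) => //; split.
    by move=> t t0; apply: is_derive_has_deriv_from0; exact: zD.
  have zc : {within `[0, +oo[, continuous z}.
    apply: derivable_within_continuous => t; rewrite in_itv/= andbT => t0.
    by case: (zD t t0).
  by move=> t; apply: (@cvg_comp _ _ _ z G _ (nbhs (z t))); [exact: zc|exact: Gc].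
(* Any solution is turned into the form required by the abstract uniqueness result: two-sided
   derivatives at interior times and continuity up to t = 0. *)
have flowD y : gradient_flow (ltnW k3) w0 y -> forall T : R,
    (forall t, t \in `]0, T[%R -> is_derive t 1 y (G (y t))) /\ {within `[0, T],
      continuous y}.
  move=> [_ [dy [yD _] dyE]] T; split; last exact: has_deriv_from0_continuous yD.
  move=> t; rewrite in_itv/= => /andP[t0 _].
  rewrite -[G _](dyE t (ltW t0)); apply/has_deriv_from0_is_derive => //.
  by apply: yD; exact: ltW.
exists z; split => // y yflow t t0.
have [zD' zc] := flowD z zflow t; have [yD yc] := flowD y yflow t.
apply: (@gradient_flow_unique _ _ _ ip _ _ G_lip
  e_ge0 e_diff e_dec y z t t0 yD zD' yc zc).
by rewrite yflow.1 zflow.1.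
Qed.
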